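(* Let $F$ be a field with $\operatorname{char}(F)\neq 2$, let $n\geq 3$ be an integer and let $m\in\{1,\dots,n-3\}$. Let $\varphi$ and $\psi$ be two non-hyperbolic, $(n-1)$-linked and totally $m$-linked $n$-fold quadratic Pfister forms over $F$. Assume there exists an $(n-1)$-fold quadratic Pfister form $\omega$ over $F$ such that (a) $\omega$ is a factor of $\varphi$, (b) $\omega$ is not a factor of $\psi$, (c) there exists an $(n-2)$-fold quadratic Pfister form that is a factor of both $\omega$ and $\psi$. Then there exists a field extension $K$ of $F$ such that $\varphi_K$ and $\psi_K$ are totally $(m+1)$-linked, are not totally $(n-1)$-linked, and neither of them is hyperbolic.
   Context: $F$ is a field of characteristic different from $2$; symmetric bilinear forms and quadratic forms are identified. Forms are considered up to isometry (equality means isometry); $\varphi_K$ denotes scalar extension to $K$. A form is hyperbolic if it is an orthogonal sum of hyperbolic planes (forms isometric to $(x,y)\mapsto xy$). A bilinear $m$-fold Pfister form is a form isometric to $\langle\!\langle\alpha_1,\dots,\alpha_m\rangle\!\rangle=\langle 1,\alpha_1\rangle\otimes\dots\otimes\langle 1,\alpha_m\rangle$ with $\alpha_i\in F^\times$ (the $0$-fold one is $\langle 1\rangle$). A quadratic $n$-fold Pfister form is a form $\langle\!\langle\alpha_1,\dots,\alpha_{n-1}\rangle\!\rangle\otimes[1,\beta]$ with $\alpha_i\in F^\times$, $\beta\in F$, where $[1,\beta]$ is the quadratic form $(x,y)\mapsto x^2+xy+\beta y^2$, required to be nonsingular. Here, for a symmetric bilinear form $B$ on $V$ and a quadratic form $\varphi$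 on $W$, $B\otimes\varphi$ is the quadratic form on $V\otimes_F W$ determined by $(B\otimes\varphi)(v\otimes w)=B(v,v)\varphi(w)$ (with polar form $B\otimes B_\varphi$, $B_\varphi(v,w)=\varphi(v+w)-\varphi(v)-\varphi(w)$). An $m$-fold quadratic Pfister form $\rho$ is a factor of an $n$-fold quadratic Pfister form $\pi$ if $\pi=B'\otimes\rho$ for some $(n-m)$-fold bilinear Pfister form $B'$. Two $n$-fold quadratic Pfister forms are $m$-linked if some $m$-fold quadratic Pfister form is a factor of both, and totally $m$-linked if every $m$-fold quadratic Pfister form is a factor of one if and only if it is a factor of the other (in characteristic not $2$ the separable and inseparable notions coincide). *)

(* Defs.v *)
From HB Require Import structures.
From mathcomp Require Import all_boot all_algebra.
From mathcomp Require Import mxtens.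
From mathcomp Require Import ring.

Set Implicit Arguments.
Unset Strict Implicit.
Unset Printing Implicit Defensive.

Import GRing.Theory.

Local Open Scope ring_scope.

Section Forms.

Variable F : fieldType.

(* A symmetric bilinear form on F^n, given by its Gram matrix. *)
Record bform := BForm {
  bdim : nat;
  bmx : 'M[F]_bdim;
  bmx_sym : bmx^T = bmx }.

Definition beval (B : bform) (x y : 'rV[F]_(bdim B)) : F :=
  (x *m bmx B *m y^T) 0 0.

(* The quadratic form x |-> x M x^T on F^n.  The matrix M need not be
   symmetric and is not determined by the form (only up to alternating
   matrices), so forms must be compared through [qeval], never by equality of
   matrices: this is what [qisometric] does. *)
Record qform := QForm {
  qdim : nat;
  qmx : 'M[F]_qdim }.

Definition qeval (q : qform) (x : 'rV[F]_(qdim q)) : F :=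
  (x *m qmx q *m x^T) 0 0.

Definition polar (q : qform) (x y : 'rV[F]_(qdim q)) : F :=
  qeval (x + y) - qeval x - qeval y.

Definition bisometric (B1 B2 : bform) : Prop :=
  exists f : {linear 'rV[F]_(bdim B1) -> 'rV[F]_(bdim B2)},
    bijective f /\ forall x y, beval (f x) (f y) = beval x y.

Definition qisometric (q1 q2 : qform) : Prop :=
  exists f : {linear 'rV[F]_(qdim q1) -> 'rV[F]_(qdim q2)},
    bijective f /\ forall x, qeval (f x) = qeval x.

Definition nonsingular (q : qform) : Prop :=
  forall x : 'rV[F]_(qdim q), (forall y, polar x y = 0) -> x = 0.

Fact bdiag_sym (s : seq F) :
  (diag_mx (\row_(i < size s) s`_i))^T = diag_mx (\row_(i < size s) s`_i).
Proof. exact: tr_diag_mx. Qed.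

Definition bdiag (s : seq F) : bform := BForm (bdiag_sym s).

Fact btens_sym (B1 B2 : bform) :
  (bmx B1 *t bmx B2)^T = bmx B1 *t bmx B2.
Proof. by rewrite trmx_tens !bmx_sym. Qed.

Definition btens (B1 B2 : bform) : bform := BForm (btens_sym B1 B2).

(* See [qeval_qtens] and [polar_qtens] below. *)
Definition qtens (B : bform) (q : qform) : qform :=
  QForm (bmx B *t qmx q).

(* (x, y) |-> a x^2 + b x y + c y^2; see [qeval_qbin]. *)
Definition qbin (a b c : F) : qform :=
  QForm (block_mx a%:M b%:M 0 c%:M : 'M[F]_(1 + 1)).

Definition hyperbolic_plane : qform := qbin 0 1 0.

Definition hyperbolic (q : qform) : Prop :=
  exists k : nat,
    qisometric q (QForm (\mxdiag_(i < k) qmx hyperbolic_plane)).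

(* <<a_1, ..., a_m>> with the convention <<a>> = <1, a>. *)
Fixpoint bpfister (s : seq F) : bform :=
  if s is a :: s' then btens (bdiag [:: 1; a]) (bpfister s')
  else bdiag [:: 1].

Definition is_bpfister (m : nat) (B : bform) : Prop :=
  exists s : seq F,
    [/\ size s = m, all (fun a => a != 0) s & bisometric B (bpfister s)].

(* There is no 0-fold quadratic Pfister form. *)
Definition is_qpfister (n : nat) (q : qform) : Prop :=
  exists (s : seq F) (b : F),
    [/\ (size s).+1 = n, all (fun a => a != 0) s, nonsingular (qbin 1 1 b)
      & qisometric q (qtens (bpfister s) (qbin 1 1 b))].

Definition is_factor (m n : nat) (rho pi : qform) : Prop :=
  [/\ (m <= n)%N, is_qpfister m rho, is_qpfister n pi
    & exists B : bform, is_bpfister (n - m) B /\ qisometric pi (qtens B rho)].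

Definition linked (n m : nat) (phi psi : qform) : Prop :=
  exists rho : qform, is_factor m n rho phi /\ is_factor m n rho psi.

Definition totally_linked (n m : nat) (phi psi : qform) : Prop :=
  forall rho : qform, is_qpfister m rho ->
    (is_factor m n rho phi <-> is_factor m n rho psi).

Lemma qeval_qbin (a b c : F) (x : 'rV[F]_(1 + 1)) :
  qeval (q := qbin a b c) x =
    a * x 0 0 ^+ 2 + b * (x 0 0 * x 0 1) + c * x 0 1 ^+ 2.
Proof.
have -> : x 0 0 = lsubmx x 0 0 by rewrite mxE; congr (x _ _); apply/val_inj.
have -> : x 0 1 = rsubmx x 0 0 by rewrite mxE; congr (x _ _); apply/val_inj.
rewrite /qeval /= -{1 2}[x]hsubmxK tr_row_mx mul_row_block mul_row_col.
rewrite mulmx0 addr0 !mul_mx_scalar !(mxE, big_ord1).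
by ring.
Qed.

Fact mulmx_tens_row (k l : nat) (v v' : 'rV[F]_k) (w w' : 'rV[F]_l)
    (A : 'M[F]_k) (C : 'M[F]_l) :
  ((v *t w : 'rV[F]_(k * l)) *m (A *t C) *m (v' *t w' : 'rV[F]_(k * l))^T) 0 0
    = (v *m A *m v'^T) 0 0 * (w *m C *m w'^T) 0 0.
Proof.
transitivity (((v *m A *m v'^T) *t (w *m C *m w'^T)) 0 0).
  by rewrite -!tensmx_mul -trmx_tens.
by rewrite mxE !ord1.
Qed.

Lemma qeval_qtens (B : bform) (q : qform)
    (v : 'rV[F]_(bdim B)) (w : 'rV[F]_(qdim q)) :
  qeval (q := qtens B q) (v *t w) = beval v v * qeval w.
Proof. exact: mulmx_tens_row. Qed.

Lemma polarE (q : qform) (x y : 'rV[F]_(qdim q)) :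
  polar x y = (x *m (qmx q + (qmx q)^T) *m y^T) 0 0.
Proof.
rewrite /polar /qeval.
have -> : x *m (qmx q + (qmx q)^T) *m y^T
          = x *m qmx q *m y^T + y *m qmx q *m x^T.
  rewrite mulmxDr mulmxDl; congr (_ + _).
  have trmx11 (A : 'M[F]_1) : A^T = A.
    by apply/matrixP => i j; rewrite mxE !ord1.
  by rewrite -[RHS]trmx11 !trmx_mul trmxK mulmxA.
rewrite linearD /= !(mulmxDl, mulmxDr).
move: (x *m _ *m x^T) (x *m _ *m y^T) (y *m _ *m x^T) (y *m _ *m y^T).
by move=> A B C D; rewrite !mxE; ring.
Qed.

Lemma polar_qtens (B : bform) (q : qform)
    (v v' : 'rV[F]_(bdim B)) (w w' : 'rV[F]_(qdim q)) :
  polar (q := qtens B q) (v *t w) (v' *t w') = beval v v' * polar w w'.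
Proof.
rewrite !polarE /beval /=.
have -> : bmx B *t qmx q + (bmx B *t qmx q)^T
          = bmx B *t (qmx q + (qmx q)^T).
  rewrite trmx_tens bmx_sym.
  by apply/matrixP => i j; rewrite !mxE mulrDr.
exact: mulmx_tens_row.
Qed.

End Forms.

Definition qext (F K : fieldType) (iota : {rmorphism F -> K}) (q : qform F) :
  qform K := QForm (map_mx iota (qmx q)).

(* Main.v *)
Require Import Defs.
From HB Require Import structures.
From mathcomp Require Import all_boot all_algebra.
From mathcomp Require Import mxtens ring zify.
From mathcomp Require Import boolp classical_sets filter.

(** In characteristic different from 2 a quadratic form is a symmetric matrix, and
a factor of an anisotropic Pfister form is the same as a Pfister subform
([factorP]).  Write phi, psi, omega for the three Pfister forms and n for the
fold of phi and psi.  What must survive along field extensions is that phi and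
psi are anisotropic and that omega, a subform of phi, is not a subform of psi
([separated]); this settles the three negative assertions.  The positive one is
reached by enlarging the field until every Pfister form rho of fold
r = m + 1 <= n - 2 that is contained in phi or in psi is contained in both.

One step.  Let rho be a subform of B, where A and B are phi and psi in some
order, and let R0 be a common subform of rho and A, of dimension smaller than
dim rho, say rho = R0 + R1 and A = R0 + A1.  Over the function field of the
quadric q = A1 - R1 the forms A1 and R1 represent a common value, so that R0
grows by one dimension; after finitely many such steps rho is contained in A.
The step preserves separation because of the subform theorem
([function_field_square]): an anisotropic Pfister form X becoming isotropic over
the function field of q contains e q for each value e <> 0 of q.  Take e to be
a value of A1; then e A is isometric to A.
- If X = A, then e A1 - e R1 is contained in e A1 + e R0, hence - R1 in R0 by
  Witt cancellation, and rho is isotropic ([common_complement_isotropic]).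
- If X = B, then A and B share e A1, which has more than half of their
  dimension, so A and B are isometric ([subform_of_big_common]).
Both cases are impossible, since B contains rho and omega separates A from B.
To keep omega outside psi the argument is run at the same time over E, the
function field of omega: omega is isotropic over E, while psi and rho stay
anisotropic there, rho because dim rho < dim omega.  For X = psi over E the case
X = A is excluded as before; in the case X = B the form A = phi is isotropic over
E, hence totally isotropic on half of its dimension, so that A1 is isotropic and
e A1 is not contained in psi.  Now psi is anisotropic over the function field of q
over E, where omega is isotropic, so that omega is not contained in psi over the
function field of q over K.  This is why function fields are built for a pair of
fields K -> E.

The subform theorem rests on the Cassels-Pfister theorem ([cassels_pfister]):
an anisotropic form representing the generic value of a diagonal form contains
that diagonal form ([generic_values]).  The function field of q is a quadratic
extension of a rational function field, and a Pfister form that becomes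
isotropic in N(sqrt delta) contains <1, - delta>, because Pfister forms are
round ([pfister_round]).

Limit.  Finitely many forms rho are treated one after the other, all forms rho
over a given field at once by an ultraproduct over the finite sets of forms
([link_all_forms]).  Each new field has new forms rho, so this is repeated
countably often, and the direct limit of the tower has the required property
([linked_extension]): a form rho, and an isometric embedding of it, are already
defined over some level, and are treated at the next one. *)

Set Implicit Arguments.
Unset Strict Implicit.
Unset Printing Implicit Defensive.

Import GRing.Theory.

Local Open Scope ring_scope.

(** * Symmetric matrices as quadratic forms *)

Section BilinearValues.
Variable F : comNzRingType.

Definition bf n (M : 'M[F]_n) (x y : 'rV[F]_n) : F := (x *m M *m y^T) 0 0.
Definition qf n (M : 'M[F]_n) (x : 'rV[F]_n) : F := bf M x x.

Definition symmx n (M : 'M[F]_n) : Prop := M^T = M.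
Definition dsum m n (A : 'M[F]_m) (B : 'M[F]_n) : 'M[F]_(m + n) :=
  block_mx A 0 0 B.

Lemma bf_mx n (M : 'M[F]_n) x y : x *m M *m y^T = (bf M x y)%:M.
Proof. by rewrite [LHS]mx11_scalar. Qed.

Lemma mulmx_line n (M : 'M[F]_n) v e :
  qf M v = e -> v *m M *m v^T = e%:M.
Proof. by move=> <-; rewrite bf_mx. Qed.

Lemma bfDl n (M : 'M[F]_n) x y z : bf M (x + y) z = bf M x z + bf M y z.
Proof. by rewrite /bf !mulmxDl mxE. Qed.

Lemma bfDr n (M : 'M[F]_n) x y z : bf M z (x + y) = bf M z x + bf M z y.
Proof. by rewrite /bf linearD /= !mulmxDr mxE. Qed.

Lemma bfZl n (M : 'M[F]_n) a x y : bf M (a *: x) y = a * bf M x y.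
Proof. by rewrite /bf -!scalemxAl mxE. Qed.

Lemma bfZr n (M : 'M[F]_n) a x y : bf M x (a *: y) = a * bf M x y.
Proof. by rewrite /bf linearZ /= -scalemxAr mxE. Qed.

Lemma bfC n (M : 'M[F]_n) x y : symmx M -> bf M x y = bf M y x.
Proof.
move=> sM; have /matrixP/(_ 0 0) : (x *m M *m y^T)^T = y *m M *m x^T.
  by rewrite !trmx_mul trmxK sM mulmxA.
by rewrite mxE.
Qed.

Lemma bf_mul m n (M : 'M[F]_n) (P : 'M_(m, n)) x y :
  bf M (x *m P) (y *m P) = bf (P *m M *m P^T) x y.
Proof. by rewrite /bf trmx_mul !mulmxA. Qed.

Lemma mulmx_conj m k l n (M : 'M[F]_n) (P : 'M_(m, k)) (Q : 'M_(k, n))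
    (R : 'M_(l, k)) :
  P *m Q *m M *m (R *m Q)^T = P *m (Q *m M *m Q^T) *m R^T.
Proof. by rewrite trmx_mul !mulmxA. Qed.

Lemma tr_scale m n a (A : 'M[F]_(m, n)) : (a *: A)^T = a *: A^T.
Proof. exact: linearZ. Qed.

Lemma conj_block_dsum m n m' n' (s : 'M[F]_m) (t : 'M[F]_n)
    (A : 'M_(m', m)) (B : 'M_(m', n)) (C : 'M_(n', m)) (D : 'M_(n', n)) :
  block_mx A B C D *m dsum s t *m (block_mx A B C D)^T =
  block_mx (A *m s *m A^T + B *m t *m B^T) (A *m s *m C^T + B *m t *m D^T)
           (C *m s *m A^T + D *m t *m B^T) (C *m s *m C^T + D *m t *m D^T).
Proof.
by rewrite /dsum tr_block_mx !mulmx_block !(mulmx0, mul0mx, addr0, add0r).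
Qed.

Lemma conj_row_dsum m n k (s : 'M[F]_m) (t : 'M[F]_n)
    (A : 'M_(k, m)) (B : 'M_(k, n)) :
  row_mx A B *m dsum s t *m (row_mx A B)^T = A *m s *m A^T + B *m t *m B^T.
Proof.
by rewrite /dsum mul_row_block tr_row_mx mul_row_col
  !(mulmx0, mul0mx, addr0, add0r).
Qed.

Lemma scale_dsum m n c (A : 'M[F]_m) (B : 'M[F]_n) :
  c *: dsum A B = dsum (c *: A) (c *: B).
Proof. by rewrite /dsum scale_block_mx !scaler0. Qed.

Lemma qf0 n (M : 'M[F]_n) : qf M 0 = 0.
Proof. by rewrite /qf /bf !mul0mx mxE. Qed.

Lemma qfD n (M : 'M[F]_n) x y : symmx M ->
  qf M (x + y) = qf M x + qf M y + 2%:R * bf M x y.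
Proof. by move=> sM; rewrite /qf !(bfDl, bfDr) [bf M y x]bfC //; ring. Qed.

Lemma qfZ n (M : 'M[F]_n) a x : qf M (a *: x) = a ^+ 2 * qf M x.
Proof. by rewrite /qf bfZl bfZr; ring. Qed.

Lemma qf_mul m n (M : 'M[F]_n) (P : 'M_(m, n)) x :
  qf M (x *m P) = qf (P *m M *m P^T) x.
Proof. exact: bf_mul. Qed.

Lemma qf_scale n (M : 'M[F]_n) a x : qf (a *: M) x = a * qf M x.
Proof. by rewrite /qf /bf -scalemxAr -scalemxAl mxE. Qed.

Lemma qf_opp n (M : 'M[F]_n) x : qf (- M) x = - qf M x.
Proof. by rewrite -scaleN1r qf_scale mulN1r. Qed.

Lemma qf_dsum m n (A : 'M[F]_m) (B : 'M[F]_n) x y :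
  qf (dsum A B) (row_mx x y) = qf A x + qf B y.
Proof.
rewrite /qf /bf /dsum mul_row_block tr_row_mx mul_row_col !mulmx0 addr0 add0r.
by rewrite mxE.
Qed.

Lemma bf_row n k (M : 'M[F]_n) (R S : 'M[F]_(k, n)) a b :
  bf M (row a R) (row b S) = (R *m M *m S^T) a b.
Proof.
rewrite /bf -row_mul tr_row !mxE; apply: eq_bigr => l _.
by rewrite !mxE.
Qed.

Lemma bf_delta n (M : 'M[F]_n) i j : bf M (delta_mx 0 i) (delta_mx 0 j) = M i j.
Proof. by rewrite /bf -rowE trmx_delta -colE !mxE. Qed.

Lemma symmx_conj m n (M : 'M[F]_n) (P : 'M_(m, n)) :
  symmx M -> symmx (P *m M *m P^T).
Proof. by move=> sM; rewrite /symmx !trmx_mul trmxK sM mulmxA. Qed.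

Lemma symmx_dsum m n (A : 'M[F]_m) (B : 'M[F]_n) :
  symmx A -> symmx B -> symmx (dsum A B).
Proof. by move=> sA sB; rewrite /symmx /dsum tr_block_mx !trmx0 sA sB. Qed.

Lemma symmx_scale n (A : 'M[F]_n) a : symmx A -> symmx (a *: A).
Proof. by move=> sA; rewrite /symmx linearZ /= sA. Qed.

Lemma symmx_opp n (A : 'M[F]_n) : symmx A -> symmx (- A).
Proof. by move=> sA; rewrite /symmx linearN /= sA. Qed.

End BilinearValues.

Lemma bf_map (R S : comNzRingType) (f : {rmorphism R -> S}) n (M : 'M[R]_n) x y :
  bf (map_mx f M) (map_mx f x) (map_mx f y) = f (bf M x y).
Proof. by rewrite /bf map_trmx -!map_mxM mxE. Qed.

Lemma qf_map (R S : comNzRingType) (f : {rmorphism R -> S}) n (M : 'M[R]_n) x :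
  qf (map_mx f M) (map_mx f x) = f (qf M x).
Proof. exact: bf_map. Qed.

Lemma two_neq0_map (K N : fieldType) (i : {rmorphism K -> N}) :
  (2%:R : K) != 0 -> (2%:R : N) != 0.
Proof. by rewrite -[X in _ -> X != 0](rmorph_nat i) fmorph_eq0. Qed.

Lemma map_dsum (R S : comNzRingType) (f : {rmorphism R -> S}) m n
    (A : 'M[R]_m) (B : 'M[R]_n) :
  map_mx f (dsum A B) = dsum (map_mx f A) (map_mx f B).
Proof. by rewrite /dsum map_block_mx !map_mx0. Qed.

Lemma symmx_map (R S : comNzRingType) (f : {rmorphism R -> S}) n (M : 'M[R]_n) :
  symmx M -> symmx (map_mx f M).
Proof. by move=> sM; rewrite /symmx map_trmx sM. Qed.

Section Gram.
Variable F : fieldType.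

Definition anisotropic n (M : 'M[F]_n) : Prop := forall x, qf M x = 0 -> x = 0.
(** The matrix [P] need not be injective.  It is when [S] is invertible, and the
relation then says that the form [S] is isometric to a subform of [M]. *)
Definition subform k n (S : 'M[F]_k) (M : 'M[F]_n) : Prop :=
  exists P : 'M[F]_(k, n), P *m M *m P^T = S.

Lemma qf_ext n (A B : 'M[F]_n) : (2%:R : F) != 0 -> symmx A -> symmx B ->
  (forall x, qf A x = qf B x) -> A = B.
Proof.
move=> c2 sA sB eqAB.
have eqb x y : bf A x y = bf B x y.
  by have := eqAB (x + y); rewrite !qfD // !eqAB => /addrI/(mulfI c2).
by apply/matrixP=> i j; have := eqb (delta_mx 0 i) (delta_mx 0 j); rewrite !bf_delta.
Qed.

Lemma symmx_subform k n (S : 'M[F]_k) (M : 'M[F]_n) :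
  symmx M -> subform S M -> symmx S.
Proof. by move=> sM [P <-]; apply: symmx_conj. Qed.

Lemma unit_dsum m n (A : 'M[F]_m) (B : 'M[F]_n) :
  (dsum A B \in unitmx) = (A \in unitmx) && (B \in unitmx).
Proof. by rewrite !unitmxE det_ublock unitrM. Qed.

Lemma unit_scale n (A : 'M[F]_n) a :
  a != 0 -> (a *: A \in unitmx) = (A \in unitmx).
Proof. by move=> a0; rewrite unitmxZ ?unitfE. Qed.

Lemma unit_scalar (e : F) : e != 0 -> (e%:M : 'M_1) \in unitmx.
Proof. by move=> e0; rewrite unitmxE det_scalar1 unitfE. Qed.

Lemma subform_refl n (M : 'M[F]_n) : subform M M.
Proof. by exists 1%:M; rewrite mul1mx trmx1 mulmx1. Qed.

Lemma subform_trans m n k (A : 'M[F]_m) (B : 'M[F]_n) (C : 'M[F]_k) :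
  subform A B -> subform B C -> subform A C.
Proof. by move=> [P <-] [Q <-]; exists (P *m Q); rewrite trmx_mul !mulmxA. Qed.

Lemma subform_dsum m n m' n' (A : 'M[F]_m) (B : 'M[F]_n)
    (A' : 'M[F]_m') (B' : 'M[F]_n') :
  subform A A' -> subform B B' -> subform (dsum A B) (dsum A' B').
Proof.
move=> [P <-] [Q <-]; exists (block_mx P 0 0 Q).
by rewrite /dsum tr_block_mx !trmx0 !mulmx_block !(mulmx0, mul0mx, addr0, add0r).
Qed.

Lemma subform_dsuml m n (A : 'M[F]_m) (B : 'M[F]_n) : subform A (dsum A B).
Proof.
exists (row_mx 1%:M 0).
rewrite /dsum mul_row_block tr_row_mx mul_row_col trmx0 trmx1.
by rewrite !(mulmx0, mul0mx, addr0, add0r, mul1mx, mulmx1).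
Qed.

Lemma subform_dsumr m n (A : 'M[F]_m) (B : 'M[F]_n) : subform B (dsum A B).
Proof.
exists (row_mx 0 1%:M).
rewrite /dsum mul_row_block tr_row_mx mul_row_col trmx0 trmx1.
by rewrite !(mulmx0, mul0mx, addr0, add0r, mul1mx, mulmx1).
Qed.

Lemma subform_dsumC m n (A : 'M[F]_m) (B : 'M[F]_n) :
  subform (dsum A B) (dsum B A).
Proof.
exists (block_mx 0 1%:M 1%:M 0); rewrite conj_block_dsum !trmx0 !trmx1.
by rewrite !(mulmx0, mul0mx, addr0, add0r, mul1mx, mulmx1).
Qed.

Lemma subform_scale m n (A : 'M[F]_m) (B : 'M[F]_n) a :
  subform A B -> subform (a *: A) (a *: B).
Proof. by move=> [P <-]; exists P; rewrite -scalemxAr -scalemxAl. Qed.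

Lemma subform_square n (A : 'M[F]_n) a : subform (a ^+ 2 *: A) A.
Proof.
exists a%:M; rewrite tr_scalar_mx mul_scalar_mx mul_mx_scalar scalerA.
by rewrite expr2.
Qed.

Lemma subform_inj k n (S : 'M[F]_k) (M : 'M[F]_n) P x :
  S \in unitmx -> P *m M *m P^T = S -> x *m P = 0 -> x = 0 :> 'rV_k.
Proof.
move=> uS eS xP; apply: (can_inj (mulmxK uS)).
by rewrite mul0mx -eS !mulmxA xP !mul0mx.
Qed.

Lemma anisotropic_subform k n (S : 'M[F]_k) (M : 'M[F]_n) :
  S \in unitmx -> subform S M -> anisotropic M -> anisotropic S.
Proof.
move=> uS [P eS] aM x; rewrite -eS -qf_mul => /aM.
exact: subform_inj eS.
Qed.

Lemma anisotropic_unit n (M : 'M[F]_n) : anisotropic M -> M \in unitmx.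
Proof.
move=> aM; rewrite -row_free_unit -kermx_eq0; apply/eqP/row_matrixP => i.
rewrite row0; apply: aM; rewrite /qf /bf -row_mul mulmx_ker.
by rewrite row0 mul0mx mxE.
Qed.

Lemma subform_row_free k n (S : 'M[F]_k) (M : 'M[F]_n) P :
  S \in unitmx -> P *m M *m P^T = S -> row_free P.
Proof.
move=> uS eS; apply/row_freeP; exists (M *m P^T *m invmx S).
by rewrite !mulmxA eS mulmxV.
Qed.

Lemma subform_leq k n (S : 'M[F]_k) (M : 'M[F]_n) :
  S \in unitmx -> subform S M -> (k <= n)%N.
Proof.
by move=> uS [P /(subform_row_free uS)/eqP <-]; apply: rank_leq_col.
Qed.

Lemma subform_conj_rev k n (S : 'M[F]_k) (M : 'M[F]_n) P : k = n ->
  row_free P -> P *m M *m P^T = S -> subform M S.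
Proof.
move=> e; subst n => fP eS.
have uP : P \in unitmx by rewrite -row_free_unit.
exists (invmx P); rewrite -eS !mulmxA mulVmx // mul1mx -mulmxA -trmx_mul.
by rewrite mulVmx // trmx1 mulmx1.
Qed.

Lemma subform_rev k n (S : 'M[F]_k) (M : 'M[F]_n) : k = n ->
  S \in unitmx -> subform S M -> subform M S.
Proof.
by move=> e uS [P eS]; apply: subform_conj_rev e (subform_row_free uS eS) eS.
Qed.

Lemma unit_of_subform k n (S : 'M[F]_k) (M : 'M[F]_n) : k = n ->
  S \in unitmx -> subform S M -> M \in unitmx.
Proof.
move=> e; subst n => uS [P eP].
by move: uS; rewrite -eP !unitmx_mul => /andP[/andP[]].
Qed.

Lemma anisotropic_dsum m n (A : 'M[F]_m) (B : 'M[F]_n) :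
  anisotropic (dsum A B) -> anisotropic A /\ anisotropic B.
Proof.
move=> a; have := anisotropic_unit a; rewrite unit_dsum => /andP[uA uB].
split; apply: anisotropic_subform a => //.
  exact: subform_dsuml.
exact: subform_dsumr.
Qed.

Lemma isotropicP n (M : 'M[F]_n) :
  anisotropic M \/ exists2 x, x != 0 & qf M x = 0.
Proof.
case: (pselect (anisotropic M)) => [|/existsNP [x /not_implyP [qx nx]]].
  by left.
by right; exists x => //; apply/eqP.
Qed.

Lemma isotropic_subform k n (S : 'M[F]_k) (M : 'M[F]_n) :
  S \in unitmx -> subform S M -> ~ anisotropic S -> ~ anisotropic M.
Proof. by move=> uS sSM nS /(anisotropic_subform uS sSM). Qed.

(** A nondegenerate subform splits off: the identity is the sum of the orthogonal
projections on it and on its complement.  A matrix identity over the base field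
is still available after scalar extension. *)
Lemma orthogonal_split k n (S : 'M[F]_k) (M : 'M[F]_n) P :
  symmx M -> S \in unitmx -> P *m M *m P^T = S ->
  exists m (B : 'M_(m, n)) (Y : 'M_(n, m)),
    [/\ (m + k)%N = n, row_free B, P *m M *m B^T = 0
      & 1%:M = M *m P^T *m invmx S *m P + Y *m B].
Proof.
move=> sM uS eS; set A := M *m P^T.
have rA : \rank A = k.
  apply/eqP; rewrite eqn_leq rank_leq_col -{1}(mxrank_unit uS) -eS -mulmxA.
  exact: mxrankM_maxr.
have sS : S^T = S by rewrite -eS; apply: symmx_conj.
exists (\rank (kermx A)), (row_base (kermx A)).
have /submxP [Y eY] : (1%:M - A *m invmx S *m P <= row_base (kermx A))%MS.
  rewrite eq_row_base sub_kermx mulmxBl mul1mx -!mulmxA (mulmxA P) eS.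
  by rewrite mulVmx // mulmx1 subrr.
exists Y; split.
- by rewrite mxrank_ker rA subnK // -rA rank_leq_row.
- exact: row_base_free.
- have BA : row_base (kermx A) *m A = 0 by apply/sub_kermxP; rewrite eq_row_base.
  move: (row_base _) BA => B BA.
  by rewrite -[RHS]trmx0 -BA /A !trmx_mul trmxK sM.
- by rewrite -eY addrC subrK.
Qed.

End Gram.

Lemma subform_map (F K : fieldType) (f : {rmorphism F -> K}) k n
    (S : 'M[F]_k) (M : 'M[F]_n) :
  subform S M -> subform (map_mx f S) (map_mx f M).
Proof. by case=> P <-; exists (map_mx f P); rewrite !map_mxM map_trmx. Qed.

Lemma subform_map_inj (K L : fieldType) (f : {rmorphism K -> L}) k n
    (S : 'M[K]_k) (M : 'M[K]_n) P :
  map_mx f P *m map_mx f M *m (map_mx f P)^T = map_mx f S -> subform S M.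
Proof.
by rewrite map_trmx -!map_mxM => /map_mx_inj <-; exists P.
Qed.

Lemma anisotropic_map (K L : fieldType) (f : {rmorphism K -> L}) n (M : 'M_n) :
  anisotropic (map_mx f M) -> anisotropic M.
Proof.
move=> aM x qx; have /aM : qf (map_mx f M) (map_mx f x) = 0.
  by rewrite qf_map qx rmorph0.
by move/eqP; rewrite map_mx_eq0 => /eqP.
Qed.

(** * Orthogonal complements and Witt cancellation *)

Section Witt.
Variable F : fieldType.

Lemma subform_complement k n (S : 'M[F]_k) (M : 'M[F]_n) :
  symmx M -> S \in unitmx -> subform S M ->
  exists m (T : 'M[F]_m),
    [/\ (m + k)%N = n, symmx T, subform (dsum S T) M, subform M (dsum S T)
      & anisotropic M -> anisotropic T].
Proof.
move=> sM uS [P eS].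
have [m [B [Y [emk fB PB e1]]]] := orthogonal_split sM uS eS.
have BP : B *m M *m P^T = 0.
  by rewrite -[RHS]trmx0 -PB !trmx_mul trmxK sM mulmxA.
have eST : col_mx P B *m M *m (col_mx P B)^T = dsum S (B *m M *m B^T).
  by rewrite mul_col_mx tr_col_mx mul_col_row eS PB BP.
exists m, (B *m M *m B^T); split=> //.
- exact: symmx_conj.
- by exists (col_mx P B).
- exists (row_mx (M *m P^T *m invmx S) Y).
  rewrite -eST !mulmxA -mulmxA -trmx_mul !mul_row_col -!mulmxA.
  by rewrite !mulmxA -e1 mul1mx trmx1 mulmx1.
- move=> aM x; rewrite -qf_mul => /aM /eqP; rewrite mulmx_free_eq0 //.
  by move/eqP.
Qed.

Hypothesis char2 : (2%:R : F) != 0.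

(** The reflection in [x - y] exchanges two vectors of the same value, and
anisotropy makes [x - y] a legitimate mirror as soon as it is nonzero.  The last
clause, that vectors pairing equally with both are fixed, allows several vectors
to be moved in turn. *)
Lemma anisotropic_reflection n (M : 'M[F]_n) x y :
  symmx M -> anisotropic M -> qf M x = qf M y ->
  exists T : 'M_n, [/\ T *m M *m T^T = M, x *m T = y
    & forall p, bf M p x = bf M p y -> p *m T = p].
Proof.
move=> sM aM exy; have [<-|nxy] := eqVneq x y.
  by exists 1%:M; split=> [||p _]; rewrite ?mul1mx ?trmx1 ?mulmx1.
have [z ez] : exists z, z = x - y by exists (x - y).
pose q := qf M z.
have q0 : q != 0.
  by apply: contra_neq nxy => /aM; rewrite ez => /subr0_eq.
pose T : 'M_n := 1%:M - (2%:R / q) *: (M *m z^T *m z).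
have TE p : p *m T = p - (2%:R / q * bf M p z) *: z.
  rewrite mulmxBr mulmx1 -scalemxAr !mulmxA bf_mx mul_scalar_mx.
  by rewrite scalerA.
have bzC p : bf M z p = bf M p z by apply: bfC.
have bT p r : bf M (p *m T) (r *m T) = bf M p r.
  rewrite !TE -!scaleNr !(bfDl, bfDr, bfZl, bfZr) bzC -/(qf M z) -/q.
  by field.
exists T; split=> [||p].
- apply: qf_ext => // [|v]; first exact: symmx_conj.
  by rewrite -qf_mul /qf bT.
- have bxz : 2%:R * bf M x z = q.
    rewrite /q ez qfD // -[- y]scaleN1r qfZ bfDr !bfZr -/(qf M x) -exy.
    by ring.
  by rewrite TE mulrAC bxz divff // scale1r ez opprB addrC subrK.
- move=> pxy; rewrite TE ez bfDr -[- y]scaleN1r bfZr pxy mulN1r subrr.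
  by rewrite mulr0 scale0r subr0.
Qed.

(** The rows of [P] are moved onto those of [Q] one after the other.  A reflection
moving row [i] fixes the rows already in place, because the Gram matrices agree. *)
Lemma witt_extension k n (M : 'M[F]_n) (P Q : 'M[F]_(k, n)) :
  symmx M -> anisotropic M -> P *m M *m P^T = Q *m M *m Q^T ->
  exists T : 'M_n, T *m M *m T^T = M /\ P *m T = Q.
Proof.
move=> sM aM ePQ.
suff /(_ k) [T [eT PT]] : forall i, exists T : 'M_n, T *m M *m T^T = M /\
    forall j : 'I_k, (j < i)%N -> row j P *m T = row j Q.
  by exists T; split=> //; apply/row_matrixP => j; rewrite row_mul PT.
elim=> [|i [T [eT PT]]].
  by exists 1%:M; split=> //; rewrite mul1mx trmx1 mulmx1.
have [lt_ik|le_ki] := ltnP i k; last first.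
  exists T; split=> // j _; apply: PT.
  exact: leq_trans (ltn_ord j) le_ki.
pose o := Ordinal lt_ik.
have bT x y : bf M (x *m T) (y *m T) = bf M x y by rewrite bf_mul eT.
have [|T' [eT' oT' fT']] :=
  @anisotropic_reflection _ M (row o P *m T) (row o Q) sM aM.
  by rewrite /qf bT !bf_row ePQ.
exists (T *m T'); split=> [|j].
  by rewrite mulmx_conj eT'.
rewrite ltnS leq_eqVlt mulmxA => /orP[/eqP ji|ji].
  by have -> : j = o by apply/val_inj.
by rewrite PT // fT' // -{1}PT // bT !bf_row ePQ.
Qed.

(** After the copy of [S] has been moved to the first summand, the vectors
orthogonal to it lie in the second one. *)
Lemma witt_cancellation k m n (S : 'M[F]_k) (T : 'M[F]_m) (U : 'M[F]_n) :
  symmx S -> symmx U -> anisotropic (dsum S U) ->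
  subform (dsum S T) (dsum S U) -> subform T U.
Proof.
move=> sS sU aSU [P eP]; have sSU := symmx_dsum sS sU.
have uS : S \in unitmx.
  by apply: anisotropic_unit; case: (anisotropic_dsum aSU).
move: eP; rewrite -[P]vsubmxK mul_col_mx tr_col_mx mul_col_row.
move: (usubmx P) (dsubmx P) => P1 P2 /eq_block_mx [e11 e12 _ e22].
have [|W [eW PW]] := @witt_extension _ _ _ P1 (row_mx 1%:M 0) sSU aSU.
  rewrite e11 /dsum mul_row_block tr_row_mx mul_row_col trmx0 trmx1.
  by rewrite !(mulmx0, mul0mx, addr0, add0r, mul1mx, mulmx1).
pose P3 := P2 *m W.
have e13 : P1 *m W *m dsum S U *m P3^T = 0.
  by rewrite /P3 mulmx_conj eW.
have e33 : P3 *m dsum S U *m P3^T = T.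
  by rewrite /P3 mulmx_conj eW.
move: e13 e33; rewrite PW -[P3]hsubmxK; move: (lsubmx P3) (rsubmx P3) => X Y.
rewrite /dsum !mul_row_block tr_row_mx !mul_row_col.
rewrite !(mulmx0, mul0mx, addr0, add0r, mul1mx) => SX.
have X0 : X = 0.
  by apply: trmx_inj; rewrite trmx0 -[X^T](mulKmx uS) SX mulmx0.
by rewrite X0 !mul0mx add0r => eY; exists Y.
Qed.

End Witt.

(** * Pfister forms *)

(** This is [2 ^ k], in the shape that orthogonal sums give to dimensions. *)
Fixpoint pdim (k : nat) : nat := if k is k'.+1 then (pdim k' + pdim k')%N else 1%N.

(** The form <1, a_0> * ... * <1, a_(k-1)>.  Slots come as an infinite sequence
for the sake of scalar extension: it composes the slots with the field morphism
and does not change the type of the matrix. *)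
Fixpoint pfister (F : fieldType) (k : nat) (a : nat -> F) : 'M[F]_(pdim k) :=
  match k with
  | 0 => 1%:M
  | k'.+1 => dsum (pfister k' a) (a k' *: pfister k' a)
  end.

Definition nonzero_upto (F : fieldType) (k : nat) (a : nat -> F) : Prop :=
  forall i, (i < k)%N -> a i != 0.

Lemma pdimE k : pdim k = (2 ^ k)%N.
Proof. by elim: k => //= k ->; rewrite expnS mul2n addnn. Qed.

Lemma leq_pdim i j : (i <= j)%N -> (pdim i <= pdim j)%N.
Proof. by move=> ij; rewrite !pdimE leq_pexp2l. Qed.

Lemma ltn_pdim i j : (i < j)%N -> (pdim i < pdim j)%N.
Proof. by move=> ij; rewrite !pdimE ltn_exp2l. Qed.

Section Pfister.
Variable F : fieldType.
Implicit Types a : nat -> F.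

Lemma nonzero_uptoS k a : nonzero_upto k.+1 a -> nonzero_upto k a /\ a k != 0.
Proof. by move=> ha; split=> [i ik|]; apply: ha => //; apply: ltnW. Qed.

Lemma symmx_pfister k a : symmx (pfister k a).
Proof.
elim: k => [|k IH] /=; first by rewrite /symmx tr_scalar_mx.
by apply: symmx_dsum => //; apply: symmx_scale.
Qed.

Lemma unit_pfister k a : nonzero_upto k a -> pfister k a \in unitmx.
Proof.
elim: k => [|k IH] /=; first by rewrite unitmx1.
by move/nonzero_uptoS=> [ha ak]; rewrite unit_dsum unit_scale // IH.
Qed.

Lemma eq_pfister k a b :
  (forall i, (i < k)%N -> a i = b i) -> pfister k a = pfister k b.
Proof.
elim: k => //= k IH eab; rewrite eab // IH // => i ik.
by apply: eab; apply: ltnW.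
Qed.

Lemma pfister_represents1 k a : exists x, qf (pfister k a) x = 1.
Proof.
elim: k => [|k [x qx]] /=.
  exists 1%:M; rewrite /qf /bf !mul1mx trmx1 mxE eqxx //.
by exists (row_mx x 0); rewrite qf_dsum qx qf0 addr0.
Qed.

(** For [s + c s] and the value [u + c v], where [u] and [v] are values of [s], the
similarity is the isometry <u, c v> = <u + c v, c u v (u + c v)>, tensored with [s],
followed by similarities of [s] with factors [u], [v] and [(u v)^-1]. *)
Lemma pfister_round k a x :
  qf (pfister k a) x != 0 ->
  exists S, S *m pfister k a *m S^T = qf (pfister k a) x *: pfister k a.
Proof.
elim: k x => [|k IH] /= x qx.
  exists (x 0 0)%:M.
  rewrite mulmx1 tr_scalar_mx -scalar_mxM scalemx1 /qf /bf mulmx1 mxE.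
  by rewrite big_ord1 mxE.
move: qx; rewrite -[x]hsubmxK; move: (lsubmx x) (rsubmx x) => {}x y.
rewrite qf_dsum qf_scale; set s := pfister k a; set c := a k.
rewrite -/s in IH; set u := qf s x; set v := qf s y => cuv.
pose zs := (mulmx0, mul0mx, addr0, add0r, trmx0).
have [u0|u0] := eqVneq u 0.
  have v0 : v != 0.
    by apply: contra_neq cuv => ->; rewrite u0 mulr0 addr0.
  have [V eV] := IH y v0; rewrite -/v in eV.
  exists (block_mx 0 V (c *: V) 0); rewrite conj_block_dsum !zs !tr_scale.
  rewrite -!(scalemxAl, scalemxAr) eV scale_block_mx !scaler0 !scalerA u0 add0r.
  by congr block_mx; congr (_ *: _); ring.
have [U eU] := IH x u0; rewrite -/u in eU.
have [v0|v0] := eqVneq v 0.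
  exists (block_mx U 0 0 U); rewrite conj_block_dsum !zs v0 mulr0 addr0.
  rewrite -!(scalemxAl, scalemxAr) eU scale_block_mx !scaler0 !scalerA.
  by congr block_mx; congr (_ *: _); ring.
have [V eV] := IH y v0; rewrite -/v in eV.
have [W eW] : exists W, W *m s *m W^T = (u * v)^-1 *: s.
  exists ((u * v)^-1 *: (U *m V)); rewrite tr_scale -!(scalemxAl, scalemxAr) mulmx_conj eV.
  rewrite -!(scalemxAl, scalemxAr) eU !scalerA; congr (_ *: _).
  by field; rewrite u0 v0.
have eUW : U *m s *m (W *m U)^T = u *: (s *m W^T).
  by rewrite trmx_mul mulmxA eU -scalemxAl.
have eVW : V *m s *m (W *m V)^T = v *: (s *m W^T).
  by rewrite trmx_mul mulmxA eV -scalemxAl.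
have eWU : W *m U *m s *m U^T = u *: (W *m s).
  by rewrite -!mulmxA (mulmxA U) eU -scalemxAr.
have eWV : W *m V *m s *m V^T = v *: (W *m s).
  by rewrite -!mulmxA (mulmxA V) eV -scalemxAr.
(* the rows (1, 1) and (- c v, u) diagonalise <u, c v>; [W] removes the factor [u v] *)
exists (block_mx U V (- (c * v) *: (W *m U)) (u *: (W *m V))).
rewrite conj_block_dsum !tr_scale -!(scalemxAl, scalemxAr).
rewrite eU eV eUW eVW eWU eWV !mulmx_conj eU eV -!(scalemxAl, scalemxAr) eW.
rewrite !scalerA -!scalerDl scale_block_mx !scaler0 !scalerA; congr block_mx.
- by rewrite -[RHS](scale0r (s *m W^T)); congr (_ *: _); ring.
- by rewrite -[RHS](scale0r (W *m s)); congr (_ *: _); ring.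
- by congr (_ *: _); field; rewrite u0 v0.
Qed.

Lemma pfister_round_subform k a e : e != 0 ->
  (exists x, qf (pfister k a) x = e) ->
  subform (e *: pfister k a) (pfister k a).
Proof. by move=> e0 [x qx]; case: (@pfister_round k a x); rewrite qx // => S; exists S. Qed.

(** An isotropic Pfister form is totally isotropic on a subspace of half its
dimension.  If [s] is anisotropic and [s + c s] takes the value 0 at [(x, y)], then
similarities [U], [V] of [s] with factors [s(x) = - c s(y)] and [s(y)] make up
the rows [(U, V)] of such a subspace. *)
Lemma isotropic_pfister k a :
  nonzero_upto k.+1 a -> ~ anisotropic (pfister k.+1 a) ->
  exists2 Z : 'M_(pdim k, pdim k.+1),
    row_free Z & Z *m pfister k.+1 a *m Z^T = 0.
Proof.
elim: k => [|k IH] /nonzero_uptoS[ha ak] nA.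
  case: (isotropicP (pfister 1 a)) => // -[Z Z0 qZ]; exists Z.
    by rewrite -row_leq_rank /= lt0n mxrank_eq0.
  by rewrite bf_mx -/(qf _ _) qZ; apply/matrixP=> i j; rewrite !mxE mul0rn.
change (~ anisotropic (dsum (pfister k.+1 a) (a k.+1 *: pfister k.+1 a))) in nA.
change (exists2 Z : 'M_(pdim k.+1, pdim k.+1 + pdim k.+1), row_free Z &
  Z *m (dsum (pfister k.+1 a) (a k.+1 *: pfister k.+1 a)) *m Z^T = 0).
have us := unit_pfister ha; have rs := @pfister_round k.+1 a.
move: (a k.+1) ak nA => c c0 nA.
have {IH}IH := IH ha; set s := pfister k.+1 a in rs nA us IH *.
have [as_|[x x0 qx]] := isotropicP s; last first.
  have [as_|Z fZ eZ] := IH; first by move: x0; rewrite (as_ _ qx) eqxx.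
  exists (block_mx Z 0 0 Z).
    by rewrite -row_leq_rank rank_diag_block_mx leq_add // row_leq_rank.
  by rewrite conj_block_dsum !(mulmx0, mul0mx, addr0, add0r, trmx0)
    -!(scalemxAl, scalemxAr) eZ scaler0 block_mx0.
case: (isotropicP (dsum s (c *: s))) => // -[x].
rewrite -[x]hsubmxK; move: (lsubmx x) (rsubmx x) => {}x y.
rewrite qf_dsum qf_scale => xy0 exy.
have v0 : qf s y != 0.
  apply: contraNneq xy0 => v0; move: exy; rewrite v0 mulr0 addr0 => /as_ ->.
  by rewrite (as_ y) // row_mx0.
have u0 : qf s x != 0.
  apply: contraNneq v0 => u0; move: exy; rewrite u0 add0r => /eqP.
  by rewrite mulf_eq0 (negPf c0).
have [U eU] := rs x u0; have [V eV] := rs y v0.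
exists (row_mx U V); last first.
  by rewrite conj_row_dsum -!(scalemxAl, scalemxAr) eU eV scalerA -scalerDl exy scale0r.
have fU : row_free U.
  by apply: subform_row_free eU; rewrite unit_scale.
have /row_freeP [X UX] := fU; apply/row_freeP; exists (col_mx X 0).
by rewrite mul_row_col mulmx0 addr0.
Qed.

(** A subspace of more than half the dimension meets every subspace of half the
dimension. *)
Lemma isotropic_big_subform m (S : 'M[F]_m) k a :
  nonzero_upto k.+1 a -> S \in unitmx -> (pdim k < m)%N ->
  subform S (pfister k.+1 a) -> ~ anisotropic (pfister k.+1 a) ->
  ~ anisotropic S.
Proof.
move=> ha uS km [P eS] nA aS.
have [Z fZ eZ] := isotropic_pfister ha nA.
have fP := subform_row_free uS eS.
have : (0 < \rank (P :&: Z)%MS)%N.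
  have := mxrank_sum_cap P Z; rewrite (eqP fP) (eqP fZ).
  have : (\rank (P + Z)%MS <= pdim k + pdim k)%N by apply: rank_leq_col.
  move: (\rank (P + Z)%MS) (\rank (P :&: Z)%MS) => r1 r2 h1 e.
  by rewrite lt0n; apply: contra_eq_neq e => ->; rewrite addn0 ltn_eqF //
    (leq_ltn_trans h1) // ltn_add2r.
rewrite lt0n mxrank_eq0 => /rowV0Pn [v].
rewrite sub_capmx => /andP[/submxP[x ex] /submxP[y ey]] v0.
have x0 : x = 0.
  by apply: aS; rewrite -eS -qf_mul -ex ey qf_mul eZ /qf /bf mulmx0 mul0mx mxE.
by move: v0; rewrite ex x0 mul0mx eqxx.
Qed.

End Pfister.

Lemma map_pfister (F K : fieldType) (f : {rmorphism F -> K}) k a :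
  map_mx f (pfister k a) = pfister k (f \o a).
Proof.
elim: k => [|k IH] /=; first by rewrite map_scalar_mx rmorph1.
by rewrite /dsum map_block_mx !map_mx0 map_mxZ IH.
Qed.

Lemma nonzero_upto_map (K L : fieldType) (f : {rmorphism K -> L}) k a :
  nonzero_upto k a -> nonzero_upto k (f \o a).
Proof. by move=> ha i ik; rewrite /= fmorph_eq0 ha. Qed.

Lemma subform_pfister_map (K L : fieldType) (f : {rmorphism K -> L}) k l s x :
  subform (pfister k s) (pfister l x) ->
  subform (pfister k (f \o s)) (pfister l (f \o x)).
Proof. by rewrite -!map_pfister; apply: subform_map. Qed.

(** * The Cassels-Pfister theorem *)

Section CasselsPfister.
Variables (F : fieldType) (n : nat) (M : 'M[F]_n).
Hypotheses (sM : symmx M) (aM : anisotropic M).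
Let MP : 'M[{poly F}]_n := map_mx polyC M.
Implicit Types f g : 'rV[{poly F}]_n.

Definition row_size_le f d := forall j, (size (f 0%R j) <= d)%N.

Lemma row_leading_coef f : f != 0 ->
  exists2 d, row_size_le f d.+1 & map_mx (coefp d) f != 0.
Proof.
move=> f0; pose d := (\max_j size (f 0%R j))%N.
have led : row_size_le f d by move=> j; apply: leq_bigmax.
have [j fj] : exists j, f 0 j != 0.
  apply/existsP; apply: contraNT f0; rewrite negb_exists => /forallP f0.
  by apply/eqP/rowP => j; rewrite mxE; apply/eqP; have := f0 j; rewrite negbK.
have d0 : (0 < d)%N.
  by apply: leq_trans (led j); rewrite lt0n size_poly_eq0.
have [|k ek] := eq_bigmax (fun j => size (f 0 j)); first by apply/card_gt0P; exists j.
exists d.-1; rewrite ?prednK //; apply: contraNneq (fj) => /rowP/(_ k).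
rewrite !mxE /d ek /= -lead_coefE => /eqP; rewrite lead_coef_eq0 => /eqP fk0.
by move: d0; rewrite /d ek fk0 size_poly0.
Qed.

Lemma coef_mul_top (p q : {poly F}) d :
  (size p <= d.+1)%N -> (size q <= d.+1)%N -> (p * q)`_(d + d) = p`_d * q`_d.
Proof.
move=> sp sq; have lt_d : (d < (d + d).+1)%N by rewrite ltnS leq_addr.
rewrite coefM (bigD1 (Ordinal lt_d)) //= addnK big1 ?addr0 // => i.
rewrite -val_eqE /= => ni; have [lt_id|lt_di|eid] := ltngtP i d.
- rewrite [X in _ * X]nth_default ?mulr0 // (leq_trans sq) //.
  by rewrite ltn_subRL ltn_add2r.
- by rewrite nth_default ?mul0r // (leq_trans sp).
- by rewrite eid eqxx in ni.
Qed.

Lemma qf_polyE f : qf MP f = \sum_i \sum_j (f 0 i * f 0 j) * (M i j)%:P.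
Proof.
rewrite /qf /bf mxE exchange_big; apply: eq_bigr => j _ /=.
rewrite !mxE big_distrl; apply: eq_bigr => i _ /=.
by rewrite !mxE mulrAC.
Qed.

Lemma coef_qf_top f d : row_size_le f d.+1 ->
  (qf MP f)`_(d + d) = qf M (map_mx (coefp d) f).
Proof.
move=> lef; rewrite qf_polyE /qf /bf mxE exchange_big coef_sum.
apply: eq_bigr => j _ /=.
rewrite !mxE big_distrl coef_sum; apply: eq_bigr => i _ /=.
by rewrite !mxE coefMC coef_mul_top // mulrAC.
Qed.

Lemma size_qf_top f d : row_size_le f d.+1 -> (size (qf MP f) <= (d + d).+1)%N.
Proof.
move=> lef; rewrite qf_polyE; apply: leq_trans (size_sum _ _ _) _; apply/bigmax_leqP => i _.
apply: leq_trans (size_sum _ _ _) _; apply/bigmax_leqP => j _; rewrite mulrC mul_polyC.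
apply: leq_trans (size_scale_leq _ _) _.
apply: leq_trans (size_polyMleq _ _) _.
by move: (lef i) (lef j); move: (size _) (size _) => a b; lia.
Qed.

(** The leading coefficients of the entries of [f] cannot cancel, because they
form a vector on which the anisotropic form [M] does not vanish. *)
Lemma size_qf f d : row_size_le f d.+1 -> map_mx (coefp d) f != 0 ->
  size (qf MP f) = (d + d).+1.
Proof.
move=> lef nz; apply/eqP; rewrite eqn_leq size_qf_top //=.
rewrite ltnNge; apply: contra_neqN nz => le.
by apply: aM; rewrite -coef_qf_top // nth_default.
Qed.

Lemma anisotropic_poly f : qf MP f = 0 -> f = 0.
Proof.
move=> qf0; apply/eqP/negPn/negP => /row_leading_coef [d lef nz].
by have := size_qf lef nz; rewrite qf0 size_poly0.
Qed.

(** A value [p] taken at the rational vector [f / h] is taken at a polynomial vector.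
Let [g] be the entrywise quotient of [f] by [h]; the line through [g] and [f / h] meets
the quadric of vectors of value [p] in a second point, whose denominator has
smaller degree than [h]. *)
Lemma cassels_pfister f h p : h != 0 -> qf MP f = h ^+ 2 * p ->
  exists g, qf MP g = p.
Proof.
have [s] := ubnP (size h); elim: s f h => // s IH f h ltsh h0 ef.
have sMP : symmx MP by apply: symmx_map.
pose g : 'rV_n := map_mx (fun u => u %/ h) f.
pose r : 'rV_n := map_mx (fun u => u %% h) f.
have fE : f = h *: g + r.
  by apply/rowP=> j; rewrite !mxE mulrC -divp_eq.
have ltr j : (size (r 0%R j) < size h)%N by rewrite mxE ltn_modp.
move: g r fE ltr => g r fE ltr.
have [r0|r0] := eqVneq r 0.
  exists g; move: ef; rewrite fE r0 addr0 qfZ.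
  by apply: mulfI; rewrite expf_eq0.
pose b := bf MP f g; pose G := qf MP g; pose h' := h * p - b *+ 2 + h * G.
have er : qf MP r = h * h'.
  have -> : r = f + (- h) *: g by rewrite fE scaleNr addrC addKr.
  by rewrite qfD // qfZ bfZr ef -/b -/G /h'; ring.
have [d ler nzr] := row_leading_coef r0.
have ltd : (d.+1 < size h)%N.
  have [j rj] : exists j, (r 0 j)`_d != 0.
    apply/existsP; apply: contraNT nzr; rewrite negb_exists => /forallP r_0.
    by apply/eqP/rowP => j; rewrite !mxE /=; apply/eqP; have := r_0 j; rewrite negbK.
  apply: leq_ltn_trans (ltr j); rewrite ltnNge; apply: contra_neqN rj => le.
  by rewrite nth_default.
have sr := size_qf ler nzr; rewrite er in sr.
have h'0 : h' != 0.
  by apply/eqP => h'0; move: sr; rewrite h'0 mulr0 size_poly0.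
have lth' : (size h' < size h)%N.
  by move: sr ltd; rewrite size_mul //; move: (size h) (size h') => u v; lia.
apply: (IH (h' *: g + (G - p) *: r) h'); first exact: leq_trans lth' _.
  by [].
have egr : bf MP g r = b - h * G.
  have -> : r = f + (- h) *: g by rewrite fE scaleNr addrC addKr.
  by rewrite bfDr bfZr bfC // -/(qf MP g) -/G mulNr.
(* with [f = h g + r], the second point is [g + (G - p) r / h'], where [h h' = M(r)] *)
rewrite qfD // !qfZ bfZl bfZr egr er -/G /h'; ring.
Qed.

End CasselsPfister.

(** * Rational function fields *)

Lemma fraction_numden (R : idomainType) (x : {fraction R}) :
  exists n d, d != 0 /\ x = FracField.tofrac n / FracField.tofrac d.
Proof.
elim/quotW: x => r; exists (frac r).1, (frac r).2; split; first exact: denom_ratioP.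
have d0 : FracField.tofrac (frac r).2 != 0 by rewrite tofrac_eq0 denom_ratioP.
apply: (mulIf d0); rewrite divfK //; unlock FracField.tofrac.
rewrite -[LHS]FracField.pi_mul; apply/eqmodP => /=.
rewrite /equivf /FracField.mulf /= !numden_Ratio ?mulf_neq0 ?denom_ratioP ?oner_neq0 //.
by rewrite !mulr1 mulrC.
Qed.

Lemma fraction_lift (R : idomainType) (L : fieldType) (h : {rmorphism R -> L}) :
  injective h ->
  exists g : {rmorphism {fraction R} -> L}, forall r, g (FracField.tofrac r) = h r.
Proof.
move=> injh.
have h0 d : d != 0 -> h d != 0.
  by apply: contra_neq => e; apply: injh; rewrite e rmorph0.
have H x : exists y, forall n d, d != 0 ->
    x = FracField.tofrac n / FracField.tofrac d -> y = h n / h d.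
  have [n [d [d0 ->]]] := fraction_numden x.
  exists (h n / h d) => n' d' d'0 /eqP.
  rewrite eqr_div ?tofrac_eq0 // -!tofracM tofrac_eq => /eqP e.
  by apply/eqP; rewrite eqr_div ?h0 // -!rmorphM e.
have [g gE'] := choice H.
have gE n d : d != 0 -> g (FracField.tofrac n / FracField.tofrac d) = h n / h d.
  by move=> d0; apply: gE'.
have gT n : g (FracField.tofrac n) = h n.
  by rewrite -[FracField.tofrac n]divr1 -tofrac1 gE ?oner_neq0 // rmorph1 divr1.
have gB : zmod_morphism g.
  move=> x y; have [n [d [d0 ->]]] := fraction_numden x.
  have [n' [d' [d'0 ->]]] := fraction_numden y.
  rewrite -mulNr addf_div ?tofrac_eq0 // -tofracN -!tofracM -tofracD.
  rewrite !gE ?mulf_neq0 // rmorphD !rmorphM rmorphN.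
  by rewrite -[- (h n' / _)]mulNr addf_div ?h0.
have gM : monoid_morphism g.
  split=> [|x y]; first by rewrite -tofrac1 gT rmorph1.
  have [n [d [d0 ->]]] := fraction_numden x.
  have [n' [d' [d'0 ->]]] := fraction_numden y.
  by rewrite mulf_div -!tofracM !gE ?mulf_neq0 // !rmorphM mulf_div.
pose G1 := GRing.isZmodMorphism.Build _ _ g gB.
pose G2 := GRing.isMonoidMorphism.Build _ _ g gM.
pose G : {rmorphism {fraction R} -> L} := HB.pack g G1 G2.
by exists G.
Qed.

Lemma common_denominator (R : idomainType) n (u : 'rV[{fraction R}]_n) :
  exists h f, h != 0 /\ map_mx (@FracField.tofrac R) f = FracField.tofrac h *: u.
Proof.
have /fin_all_exists [nn /fin_all_exists [dd H]] j := fraction_numden (u 0 j).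
exists (\prod_j dd j), (\row_j (nn j * \prod_(k | k != j) dd k)); split.
  by apply/prodf_neq0 => j _; case: (H j).
apply/rowP => j; rewrite !mxE; case: (H j) => dj ->.
rewrite [in RHS](bigD1 j) //= !tofracM [RHS]mulrC mulrA divfK ?tofrac_eq0 //.
Qed.

(** The element [t] behaves like an indeterminate for anisotropic forms.  For [a = 0]
the second clause says that a constant represented over [L] is represented over
[K]. *)
Definition generic_element (K L : fieldType) (i : {rmorphism K -> L}) (t : L) : Prop :=
  forall n (M : 'M[K]_n), symmx M -> anisotropic M ->
    anisotropic (map_mx i M) /\
    forall u g a, qf (map_mx i M) u = i g + i a * t ^+ 2 ->
      exists v w, [/\ qf M v = g, qf M w = a & bf M v w = 0].

Section RationalFunctions.
Variable K : fieldType.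
Hypothesis char2 : (2%:R : K) != 0.

Definition const_fraction : {rmorphism K -> {fraction {poly K}}} :=
  [the {rmorphism K -> {fraction {poly K}}} of
   (@FracField.tofrac {poly K}) \o (@polyC K)].

(** By the Cassels-Pfister theorem the value is taken at a polynomial vector.
Its degree is at most 1, since a form value has twice the degree of the
vector; comparing coefficients of [v + X w] gives the three equations. *)
Lemma generic_X : generic_element const_fraction (FracField.tofrac 'X).
Proof.
move=> n M sM aM.
have eM : map_mx const_fraction M = map_mx (@FracField.tofrac _) (map_mx polyC M).
  by rewrite -map_mx_comp.
split=> [u|u g a].
  have [h [f [h0 ef]]] := common_denominator u.
  move=> qu; have : qf (map_mx polyC M) f = 0.
    apply/eqP; rewrite -tofrac_eq0 -qf_map -eM ef qfZ qu mulr0 //.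
  move/(anisotropic_poly aM) => f0; move: ef; rewrite f0 map_mx0 => /esym/eqP.
  by rewrite scaler_eq0 tofrac_eq0 (negPf h0) => /eqP.
have [h [f [h0 ef]]] := common_denominator u => qu.
have [f0 qf0] : exists f0, qf (map_mx polyC M) f0 = g%:P + a%:P * 'X ^+ 2.
  apply: (@cassels_pfister _ _ _ sM aM f h) => //.
  apply/eqP; rewrite -tofrac_eq -qf_map -eM ef qfZ qu.
  by rewrite !(tofracM, tofracD, tofracXn).
pose v := map_mx (coefp 0) f0; pose w := map_mx (coefp 1) f0.
have f0E : f0 = map_mx polyC v + 'X *: map_mx polyC w.
  have [f00|/row_leading_coef [d lef nz]] := eqVneq f0 0.
    by rewrite /v /w f00 !map_mx0 scaler0 addr0.
  have := size_qf aM lef nz; rewrite qf0 => sz.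
  have d1 : (d.+1 <= 2)%N.
    have : (size (g%:P + a%:P * 'X ^+ 2 : {poly K})%R <= 3)%N.
      rewrite (leq_trans (size_polyD _ _)) // geq_max.
      rewrite (leq_trans (size_polyC_leq1 _)) //= mul_polyC.
      by rewrite (leq_trans (size_scale_leq _ _)) // size_polyXn.
    by rewrite sz; lia.
  apply/rowP => j; rewrite !mxE /=; apply/polyP => k.
  have sj := leq_trans (lef j) d1.
  rewrite coefD coefC mulrC coefMX coefC.
  case: k => [|[|k]] /=; rewrite ?addr0 ?add0r //.
  by rewrite nth_default // (leq_trans sj).
have smP : symmx (map_mx polyC M) by apply: symmx_map.
move: qf0; rewrite f0E qfD // qfZ bfZr !qf_map bf_map => /polyP eqc.
exists v, w; split.
- have := eqc 0%N; rewrite mulr_natl.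
  rewrite !(coefD, coefMn, coefC, coefCM, coefXM, coefXnM) /=.
  by rewrite !mulr0 !addr0.
- have := eqc 2%N; rewrite mulr_natl.
  rewrite !(coefD, coefMn, coefC, coefCM, coefXM, coefXnM) /=.
  by rewrite coefX mulr1 !add0r !addr0.
- have := eqc 1%N; rewrite mulr_natl.
  rewrite !(coefD, coefMn, coefC, coefCM, coefXM, coefXnM) /=.
  rewrite coefX mulr0 !add0r -mulr2n -mulr_natl => /eqP.
  by rewrite mulf_eq0 (negPf char2) => /eqP.
Qed.

End RationalFunctions.

Lemma rational_function_square (K E : fieldType) (j : {rmorphism K -> E}) :
  (2%:R : K) != 0 ->
  exists (K1 E1 : fieldType) (iK : {rmorphism K -> K1}) (iE : {rmorphism E -> E1})
     (j1 : {rmorphism K1 -> E1}) (t : K1),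
   [/\ forall x, j1 (iK x) = iE (j x), t != 0, generic_element iK t
     & generic_element iE (j1 t)].
Proof.
move=> c2.
have c2E : (2%:R : E) != 0 by rewrite -(rmorph_nat j) fmorph_eq0.
pose h : {rmorphism {poly K} -> {fraction {poly E}}} :=
  [the {rmorphism {poly K} -> {fraction {poly E}}} of
    (@FracField.tofrac {poly E}) \o (map_poly j)].
have [|j1 ej1] := @fraction_lift _ _ h.
  move=> p q /= /eqP; rewrite tofrac_eq => /eqP.
  exact: map_poly_inj.
exists {fraction {poly K}}, {fraction {poly E}}, (const_fraction K), (const_fraction E), j1.
exists (FracField.tofrac 'X); split.
- by move=> x; rewrite /= ej1 /= map_polyC.
- by rewrite tofrac_eq0 polyX_eq0.
- exact: generic_X.
- by rewrite ej1 /= map_polyX; apply: generic_X.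
Qed.

(** * Generic values of diagonal forms *)

(** The new coefficient comes first: the size [1 + m] of the block matrix is then
convertible to [m.+1]. *)
Fixpoint diagform (F : fieldType) (m : nat) (d : nat -> F) : 'M[F]_m :=
  match m with
  | 0 => 0
  | m'.+1 => @dsum F 1 m' (d m')%:M (diagform m' d)
  end.

Lemma map_diagform (F K : fieldType) (f : {rmorphism F -> K}) m d :
  map_mx f (diagform m d) = diagform m (f \o d).
Proof.
elim: m => [|m IH] /=; first by rewrite map_mx0.
by rewrite [LHS](@map_dsum _ _ f 1 m) map_scalar_mx IH.
Qed.

Lemma eq_diagform (F : fieldType) m (d d' : nat -> F) :
  (forall i, (i < m)%N -> d i = d' i) -> diagform m d = diagform m d'.
Proof.
elim: m => //= m IH e; rewrite e // IH // => i im.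
by apply: e; apply: ltnW.
Qed.

Lemma scale_diagform (F : fieldType) m c (d : nat -> F) :
  c *: diagform m d = diagform m (fun i => c * d i).
Proof.
elim: m => [|m IH] /=; first by rewrite scaler0.
by rewrite [LHS](@scale_dsum _ 1 m) scale_scalar_mx IH.
Qed.

Lemma unit_diagform (F : fieldType) m (d : nat -> F) :
  nonzero_upto m d -> diagform m d \in unitmx.
Proof.
elim: m => [|m IH] /=; first by rewrite unitmxE det_mx00 unitr1.
by move/nonzero_uptoS => [hd dm]; rewrite (@unit_dsum _ 1 m) unit_scalar // IH.
Qed.

Lemma diagonalization (F : fieldType) m (T : 'M[F]_m) :
  symmx T -> anisotropic T ->
  exists d, [/\ nonzero_upto m d, subform (diagform m d) T & subform T (diagform m d)].
Proof.
elim: m T => [|m IH] T sT aT.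
  by exists (fun=> 0); split=> //; exists 0; apply/matrixP=> -[].
pose v : 'rV[F]_m.+1 := delta_mx 0 0; pose e := qf T v.
have e0 : e != 0.
  apply/eqP => /aT /rowP/(_ 0); rewrite !mxE eqxx => /eqP.
  by rewrite oner_eq0.
have ev : v *m T *m v^T = e%:M by apply: mulmx_line.
have se : subform (e%:M : 'M_1) T by exists v.
have [m' [T' [em sT' s1 s2 aT']]] := subform_complement sT (unit_scalar e0) se.
have em' : m' = m by move: em; rewrite addn1 => -[].
subst m'; have [d [hd s3 s4]] := IH T' sT' (aT' aT).
pose d' i := if i == m then e else d i.
have ed : diagform m.+1 d' = @dsum F 1 m e%:M (diagform m d).
  have -> : diagform m d = diagform m d'.
    by apply: eq_diagform => i im; rewrite /d' ltn_eqF.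
  by rewrite /= {1}/d' eqxx.
exists d'; split.
- by move=> i; rewrite ltnS leq_eqVlt /d'; case: eqP => //= _ /hd.
- rewrite ed; apply: subform_trans s1.
  exact: (@subform_dsum F 1 m 1 m) (subform_refl _) s3.
- rewrite ed; apply: subform_trans s2 _.
  exact: (@subform_dsum F 1 m 1 m) (subform_refl _) s4.
Qed.

Section Extension.
Variables (K N : fieldType) (i : {rmorphism K -> N}).
Hypothesis char2 : (2%:R : K) != 0.

(** The vector [w] of constant value [e] over [N] is moved by a reflection to a
vector [w0] defined over [K], so that the complement of [w0], also defined over
[K], takes the value of [v]. *)
Lemma split_off_constant n (M : 'M[K]_n) w0 e v w :
  symmx M -> anisotropic M -> anisotropic (map_mx i M) ->
  e != 0 -> qf M w0 = e -> qf (map_mx i M) w = i e ->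
  bf (map_mx i M) v w = 0 ->
  exists m (M1 : 'M[K]_m), [/\ symmx M1, anisotropic M1,
    subform (dsum (e%:M : 'M_1) M1) M
    & exists y, qf (map_mx i M1) y = qf (map_mx i M) v].
Proof.
move=> sM aM aMN e0 qw0 qw bvw; have sMN := symmx_map i sM.
have [|T [eT wT _]] := @anisotropic_reflection _ (two_neq0_map i char2) _ _
  w (map_mx i w0) sMN aMN.
  by rewrite qf_map qw0.
have bT x y : bf (map_mx i M) (x *m T) (y *m T) = bf (map_mx i M) x y.
  by rewrite bf_mul eT.
have [m [B [Y [_ fB PB e1]]]] :=
  orthogonal_split sM (unit_scalar e0) (mulmx_line qw0).
have BP : B *m M *m w0^T = 0.
  by rewrite -[RHS]trmx0 -PB !trmx_mul trmxK sM mulmxA.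
exists m, (B *m M *m B^T); split; first exact: symmx_conj.
- move=> x; rewrite -qf_mul => /aM /eqP; rewrite mulmx_free_eq0 //.
  by move/eqP.
- exists (col_mx w0 B); rewrite mul_col_mx tr_col_mx mul_col_row.
  by rewrite PB BP (mulmx_line qw0).
exists (v *m T *m map_mx i Y).
rewrite -[RHS]/(bf (map_mx i M) v v) -bT -/(qf (map_mx i M) (v *m T)).
rewrite !map_mxM /= -map_trmx -qf_mul.
congr qf; rewrite -[RHS]mulmx1 -(map_mx1 i) e1 map_mxD !map_mxM /= mulmxDr.
rewrite !mulmxA -map_trmx bf_mx -wT bT bvw.
by rewrite mul_scalar_mx scale0r !mul0mx add0r.
Qed.

(** The element [g] stands for [d_0 x_0^2 + ... + d_(m-1) x_(m-1)^2] with
indeterminates [x_i]: a form over [K] represents it over [N] only if it contains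
the diagonal form itself. *)
Definition generic_value m (d : nat -> K) (g : N) : Prop :=
  forall n (M : 'M[K]_n), symmx M -> anisotropic M ->
  [/\ anisotropic (map_mx i M),
      forall u c, qf (map_mx i M) u = i c -> exists v, qf M v = c
    & forall u, qf (map_mx i M) u = g -> subform (diagform m d) M].

End Extension.

(** Representing [g + d_m t^2] with [t] generic yields orthogonal vectors of values
[g] and [d_m]; once the second one is split off, the induction hypothesis
applies to the complement. *)
Lemma generic_value_step (K N N1 : fieldType) (i : {rmorphism K -> N})
    (i1 : {rmorphism N -> N1}) m d g t :
  (2%:R : K) != 0 -> d m != 0 -> generic_value i m d g -> generic_element i1 t ->
  generic_value [the {rmorphism K -> N1} of i1 \o i] m.+1 d
    (i1 (i (d m)) * t ^+ 2 + i1 g).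
Proof.
move=> c2 dm0 Hg Ht n M sM aM.
have [aMN repc repg] := Hg n M sM aM.
have eM : map_mx (i1 \o i) M = map_mx i1 (map_mx i M) by rewrite map_mx_comp.
have [aMN1 rept] := Ht n _ (symmx_map i sM) aMN.
split=> [|u c|u]; rewrite [map_mx _ _]eM //.
  move=> qu; have [|v [w [qv _ _]]] := rept u (i c) 0.
    by rewrite qu rmorph0 mul0r addr0.
  exact: repc qv.
rewrite addrC => /rept [v [w [qv qw bvw]]].
have [w0 qw0] := repc _ _ qw.
have [m1 [M1 [sM1 aM1 s1 [y qy]]]] := split_off_constant c2 sM aM aMN dm0 qw0 qw bvw.
have [_ _ /(_ y)] := Hg _ M1 sM1 aM1; rewrite qy qv => /(_ erefl) s2.
apply: subform_trans s1.
exact: (@subform_dsum _ 1 m 1 m1) (subform_refl _) s2.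
Qed.

Lemma generic_values (K E : fieldType) (j : {rmorphism K -> E}) m (d : nat -> K) :
  (2%:R : K) != 0 -> nonzero_upto m d ->
  exists (N NE : fieldType) (iK : {rmorphism K -> N}) (iE : {rmorphism E -> NE})
    (jN : {rmorphism N -> NE}) (x : 'rV[N]_m),
  let g := qf (map_mx iK (diagform m d)) x in
  [/\ forall z, jN (iK z) = iE (j z), (0 < m)%N -> x != 0,
      generic_value iK m d g & generic_value iE m (j \o d) (jN g)].
Proof.
move=> c2; have c2E : (2%:R : E) != 0 by apply: two_neq0_map c2.
elim: m => [_|m IH /nonzero_uptoS [hd dm]].
  have base (L : fieldType) (d' : nat -> L) g : generic_value idfun 0 d' g.
    move=> n M sM aM; rewrite map_mx_id; split=> // [u c qu|u _].
      by exists u.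
    by exists 0; apply/matrixP=> -[].
  by exists K, E, idfun, idfun, j, 0; split.
have [N [NE [iK [iE [jN [x [comm x0 gK gE]]]]]]] := IH hd.
have c2N : (2%:R : N) != 0 by apply: (two_neq0_map iK).
have [K1 [E1 [i1 [e1 [j1 [t [comm1 t0 tK tE]]]]]]] :=
  rational_function_square jN c2N.
exists K1, E1, [the {rmorphism K -> K1} of i1 \o iK],
  [the {rmorphism E -> E1} of e1 \o iE], j1,
  (row_mx t%:M (map_mx i1 x) : 'rV_(1 + m)).
have eg : qf (map_mx (i1 \o iK) (diagform m.+1 d)) (row_mx t%:M (map_mx i1 x)) =
    i1 (iK (d m)) * t ^+ 2 + i1 (qf (map_mx iK (diagform m d)) x).
  have -> : map_mx (i1 \o iK) (diagform m.+1 d) = @dsum K1 1 m (i1 (iK (d m)))%:M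
      (map_mx i1 (map_mx iK (diagform m d))).
    by rewrite [LHS](@map_dsum _ _ _ 1 m) map_scalar_mx map_mx_comp.
  rewrite [LHS](@qf_dsum _ 1 m) qf_map; congr (_ + _).
  rewrite /qf /bf -scalar_mxM tr_scalar_mx.
  by rewrite -scalar_mxM mxE eqxx mulr1n; ring.
split=> [z|_||]; rewrite ?eg.
- by rewrite /= comm1 comm.
- apply: contraNneq t0 => e0; have := congr1 (fun z : 'rV_(1 + m) => lsubmx z 0 0) e0.
  by rewrite row_mxKl !mxE eqxx mulr1n => ->.
- exact: generic_value_step.
- rewrite rmorphD rmorphM rmorphXn !comm1 comm.
  by apply: (@generic_value_step _ _ _ iE e1 m (j \o d)); rewrite //= fmorph_eq0.
Qed.

(** * Quadratic extensions *)

Section SquareRootExtension.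
Variables (N : fieldType) (delta : N).
Hypothesis nonsquare : forall y, y ^+ 2 != delta.

(** Pairs [(a, b)] stand for [a + b sqrt delta].  The nonsquare hypothesis is a
parameter of the type so that the field structure can be found from the type. *)
Definition sqrt_ext of (forall y, y ^+ 2 != delta) : Type := (N * N)%type.
Local Notation L := (sqrt_ext nonsquare).

HB.instance Definition _ := GRing.Zmodule.copy L (N * N)%type.

Definition sqrt_ext_one : L := (1, 0).
Definition sqrt_ext_mul (x y : L) : L :=
  (x.1 * y.1 + delta * (x.2 * y.2), x.1 * y.2 + x.2 * y.1).
Definition sqrt_ext_norm (x : L) : N := x.1 ^+ 2 - delta * x.2 ^+ 2.
Definition sqrt_ext_inv (x : L) : L :=
  (x.1 / sqrt_ext_norm x, - x.2 / sqrt_ext_norm x).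

Lemma sqrt_ext_mulA : associative sqrt_ext_mul.
Proof. by move=> [a b] [c d] [e f]; congr pair; rewrite /=; ring. Qed.

Lemma sqrt_ext_mulC : commutative sqrt_ext_mul.
Proof. by move=> [a b] [c d]; congr pair; rewrite /=; ring. Qed.

Lemma sqrt_ext_mul1 : left_id sqrt_ext_one sqrt_ext_mul.
Proof. by move=> [a b]; congr pair; rewrite /=; ring. Qed.

Lemma sqrt_ext_mulDl : left_distributive sqrt_ext_mul +%R.
Proof. by move=> [a b] [c d] [e f]; congr pair; rewrite /=; ring. Qed.

Lemma sqrt_ext_one_neq0 : sqrt_ext_one != 0.
Proof. by apply/eqP => -[/eqP]; rewrite oner_eq0. Qed.

HB.instance Definition _ := GRing.Zmodule_isComNzRing.Build L
  sqrt_ext_mulA sqrt_ext_mulC sqrt_ext_mul1 sqrt_ext_mulDl sqrt_ext_one_neq0.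

Lemma sqrt_ext_norm_neq0 (x : L) : x != 0 -> sqrt_ext_norm x != 0.
Proof.
case: x => a b; rewrite /sqrt_ext_norm /= => x0.
have [b0|b0] := eqVneq b 0.
  rewrite b0 expr0n mulr0 subr0 expf_neq0 //.
  by apply: contraNneq x0 => a0; rewrite a0 b0.
rewrite subr_eq0; apply: contraNneq (nonsquare (a / b)) => e.
by rewrite expr_div_n e mulfK // expf_neq0.
Qed.

Lemma sqrt_ext_mulV (x : L) : x != 0 -> sqrt_ext_inv x * x = 1.
Proof.
move=> /sqrt_ext_norm_neq0; case: x => a b; rewrite /sqrt_ext_norm /= => n0.
by congr pair; rewrite /= /sqrt_ext_norm /=; field.
Qed.

Lemma sqrt_ext_inv0 : sqrt_ext_inv 0 = 0.
Proof. by congr pair; rewrite /= ?oppr0 mul0r. Qed.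

HB.instance Definition _ := GRing.ComNzRing_isField.Build L
  sqrt_ext_mulV sqrt_ext_inv0.

Definition sqrt_ext_const (x : N) : L := (x, 0).

Lemma sqrt_ext_const_is_zmod_morphism : zmod_morphism sqrt_ext_const.
Proof. by move=> x y; congr pair; rewrite /= subr0. Qed.

Lemma sqrt_ext_const_is_monoid_morphism : monoid_morphism sqrt_ext_const.
Proof. by split=> // x y; congr pair; rewrite /=; ring. Qed.

HB.instance Definition _ := GRing.isZmodMorphism.Build N L sqrt_ext_const
  sqrt_ext_const_is_zmod_morphism.
HB.instance Definition _ := GRing.isMonoidMorphism.Build N L sqrt_ext_const
  sqrt_ext_const_is_monoid_morphism.

Definition sqrt_ext_root : L := (0, 1).

Lemma sqrt_ext_rootE : sqrt_ext_root ^+ 2 = sqrt_ext_const delta.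
Proof. by congr pair; rewrite /=; ring. Qed.

Lemma sqrt_extE (x : L) :
  x = sqrt_ext_const x.1 + sqrt_ext_root * sqrt_ext_const x.2.
Proof. by case: x => a b; congr pair; rewrite /=; ring. Qed.

Lemma sqrt_ext_lift (L2 : fieldType) (h : {rmorphism N -> L2}) z :
  z ^+ 2 = h delta ->
  exists h' : {rmorphism L -> L2}, forall x, h' (sqrt_ext_const x) = h x.
Proof.
move=> ez; pose g (x : L) := h x.1 + z * h x.2.
have gB : zmod_morphism g.
  by move=> [a b] [c d]; rewrite /g /= !rmorphB; ring.
have gM : monoid_morphism g.
  split=> [|[a b] [c d]]; first by rewrite /g /= rmorph1 rmorph0 mulr0 addr0.
  by rewrite /g /= !(rmorphM, rmorphD) -ez; ring.
pose G1 := GRing.isZmodMorphism.Build _ _ g gB.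
pose G2 := GRing.isMonoidMorphism.Build _ _ g gM.
pose G : {rmorphism L -> L2} := HB.pack g G1 G2.
by exists G => x; rewrite /= /g /= rmorph0 mulr0 addr0.
Qed.

(** The two components of the value at [u + v sqrt delta] are the value of [u] plus
[delta] times the value of [v], and twice the pairing of [u] with [v]. *)
Lemma sqrt_ext_isotropic n (M : 'M[N]_n) :
  (2%:R : N) != 0 -> symmx M -> anisotropic M ->
  ~ anisotropic (map_mx sqrt_ext_const M) ->
  exists u v, [/\ v != 0, qf M u = - delta * qf M v & bf M u v = 0].
Proof.
move=> c2 sM aM nA; case: (isotropicP (map_mx sqrt_ext_const M)) => // -[x x0 qx].
pose u : 'rV[N]_n := map_mx (fun z : L => z.1) x.
pose v : 'rV[N]_n := map_mx (fun z : L => z.2) x.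
have xE : x = map_mx sqrt_ext_const u + sqrt_ext_root *: map_mx sqrt_ext_const v.
  by apply/rowP=> k; rewrite !mxE [LHS]sqrt_extE.
move: u v xE => u v xE; move: qx; rewrite xE qfD; last exact: symmx_map.
rewrite qfZ bfZr !qf_map bf_map sqrt_ext_rootE -(rmorph_nat sqrt_ext_const).
move=> e; have e1 := congr1 (fun z : L => z.1) e; have e2 := congr1 (fun z : L => z.2) e.
move: e1 e2; rewrite /= !(mulr0, mul0r, addr0, add0r, mul1r) => e1 /eqP.
rewrite mulf_eq0 (negPf c2) /= => /eqP e2.
have qu : qf M u = - delta * qf M v by apply/eqP; rewrite mulNr -addr_eq0 e1.
exists u, v; split=> //; apply: contraNneq x0 => v0.
by rewrite xE v0 (aM u) ?map_mx0 ?scaler0 ?addr0 // qu v0 qf0 mulr0.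
Qed.

End SquareRootExtension.

(** If [delta] is already a square then [L = N], and no anisotropic form becomes
isotropic.  The universal property serves to map the extension over [K] into the
one over [E], where [delta] may have become a square. *)
Lemma square_root_extension (N : fieldType) (delta : N) : (2%:R : N) != 0 ->
  exists (L : fieldType) (i : {rmorphism N -> L}) (y : L),
  [/\ y ^+ 2 = i delta,
      forall n (M : 'M[N]_n), symmx M -> anisotropic M ->
        ~ anisotropic (map_mx i M) ->
        exists u v, [/\ v != 0, qf M u = - delta * qf M v & bf M u v = 0]
    & forall (L2 : fieldType) (h : {rmorphism N -> L2}) z, z ^+ 2 = h delta ->
        exists h' : {rmorphism L -> L2}, forall x, h' (i x) = h x].
Proof.
move=> c2; case: (pselect (exists y, y ^+ 2 = delta)) => [[y ey]|/forallNP ns].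
  exists N, idfun, y; split=> // [n M _ aM|L2 h z _].
    by rewrite map_mx_id //.
  by exists h.
have nsq y : y ^+ 2 != delta by apply/eqP.
exists (sqrt_ext nsq), (sqrt_ext_const nsq), (sqrt_ext_root nsq); split.
- exact: sqrt_ext_rootE.
- by move=> n M; apply: sqrt_ext_isotropic.
- exact: sqrt_ext_lift.
Qed.

(** * Function fields of quadrics *)

(** If [X] becomes isotropic over [N(sqrt (- g))], it contains <g s, s> over [N] for some
nonzero value [s], hence <g, 1> by roundness.  Since the value 1 is already taken
over [K], it splits off over [K]; the complement represents the generic value [g]. *)
Lemma isotropic_over_quadric_field (K N L : fieldType) (i : {rmorphism K -> N})
    (h : {rmorphism N -> L}) m d g k a :
  (2%:R : K) != 0 -> nonzero_upto k a ->
  generic_value i m d g ->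
  (forall n (M : 'M[N]_n), symmx M -> anisotropic M ->
    ~ anisotropic (map_mx h M) ->
    exists u v, [/\ v != 0, qf M u = - - g * qf M v & bf M u v = 0]) ->
  anisotropic (pfister k a) ->
  ~ anisotropic (map_mx h (map_mx i (pfister k a))) ->
  subform (dsum (1%:M : 'M_1) (diagform m d)) (pfister k a).
Proof.
move=> c2 ha gen Hh aX; have sX := symmx_pfister k a.
have [aXN _ _] := gen _ _ sX aX.
move/(Hh _ _ (symmx_map i sX) aXN); rewrite opprK => -[u [v [v0 qu buv]]].
set X := map_mx i (pfister k a) in aXN qu buv *.
have s0 : qf X v != 0 by apply: contraNneq v0 => /aXN ->.
have [S eS] : exists S, S *m X *m S^T = qf X v *: X.
  by move: s0; rewrite /X map_pfister; apply: pfister_round.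
set s := qf X v in s0 eS qu.
have bS x y : bf X (s^-1 *: (x *m S)) (s^-1 *: (y *m S)) = s^-1 * bf X x y.
  rewrite bfZl bfZr bf_mul eS /bf -scalemxAr -scalemxAl mxE.
  by field.
have [r0 qr0] := pfister_represents1 k a.
have [||m1 [M1 [sM1 aM1 s1 [y qy]]]] := @split_off_constant _ _ i c2 _ _ r0 1
  (s^-1 *: (u *m S)) (s^-1 *: (v *m S)) sX aX aXN (oner_neq0 _) qr0.
- by rewrite rmorph1 /qf bS mulVf.
- by rewrite bS buv mulr0.
have [_ _ /(_ y)] := gen _ M1 sM1 aM1.
rewrite qy /qf bS -/(qf _ u) qu mulrCA mulVf // mulr1 => /(_ erefl) s2.
apply: subform_trans s1.
exact: (@subform_dsum _ 1 m 1 m1) (subform_refl _) s2.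
Qed.

(** The subform theorem of Cassels and Pfister for the function field [K1] of the
quadric of [q], together with its analogue over an extension [E] of [K].  For
anisotropic [q = <e> + d] with [d] diagonal, [K1] is [N(sqrt (- g))] for the
generic value [g] of [e d], and [e q] is isometric to [<1> + e d]. *)
Lemma function_field_square (K E : fieldType) (j : {rmorphism K -> E})
    n (q : 'M[K]_n) v e :
  (2%:R : K) != 0 -> (1 < n)%N -> symmx q -> e != 0 -> qf q v = e ->
  exists (K1 E1 : fieldType) (iK : {rmorphism K -> K1}) (iE : {rmorphism E -> E1})
    (j1 : {rmorphism K1 -> E1}),
  [/\ forall x, j1 (iK x) = iE (j x),
      ~ anisotropic (map_mx iK q),
      forall k a, nonzero_upto k a -> anisotropic (pfister k a) ->
        ~ anisotropic (map_mx iK (pfister k a)) ->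
        subform (e *: q) (pfister k a)
    & forall k a, nonzero_upto k a -> anisotropic (pfister k a) ->
        ~ anisotropic (map_mx iE (pfister k a)) ->
        subform (j e *: map_mx j q) (pfister k a)].
Proof.
move=> c2 n1 sq e0 qv.
have [aq|naq] := pselect (anisotropic q); last first.
  exists K, E, idfun, idfun, j; rewrite map_mx_id //.
  by split=> // k a _ aX; rewrite map_mx_id //.
have se : subform (e%:M : 'M_1) q by exists v; apply: mulmx_line.
have [m [T [em sT s1 s2 aT]]] := subform_complement sq (unit_scalar e0) se.
have [d [hd s3 s4]] := diagonalization sT (aT aq).
have m0 : (0 < m)%N by move: n1; rewrite -em addn1.
have c2E := two_neq0_map j c2.
pose ed l := e * d l.
have hed : nonzero_upto m ed by move=> l lm; rewrite mulf_neq0 // hd.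
have [N [NE [iK [iE [jN [x [comm x0 gK gE]]]]]]] := generic_values j c2 hed.
set g := qf _ x in gK gE.
have c2N := two_neq0_map iK c2; have c2NE := two_neq0_map iE c2E.
have [K1 [hK [y [ey Hy lift]]]] := square_root_extension (- g) c2N.
have [E1 [hE [z [ez Hz _]]]] := square_root_extension (jN (- g)) c2NE.
have [|j1 ej1] := lift E1 [the {rmorphism N -> E1} of hE \o jN] z; first exact: ez.
have sq_dsum (L : fieldType) (f : {rmorphism K -> L}) :
    subform (f e *: map_mx f q)
      (dsum (1%:M : 'M_1) (diagform m (f \o ed))).
  have s5 : subform q (dsum (e%:M : 'M_1) (diagform m d)).
    exact: subform_trans s2 (@subform_dsum _ 1 m 1 m _ _ _ _ (subform_refl _) s4).
  apply: subform_trans (subform_scale (f e) (subform_map f s5)) _.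
  rewrite map_dsum scale_dsum map_diagform scale_diagform map_scalar_mx.
  rewrite (@eq_diagform _ m _ (f \o ed)); last first.
    by move=> l _; rewrite /= /ed rmorphM.
  apply: (@subform_dsum _ 1 m 1 m); last exact: subform_refl.
  by rewrite scale_scalar_mx -expr2 -[_%:M]scalemx1; apply: subform_square.
exists K1, E1, [the {rmorphism K -> K1} of hK \o iK],
  [the {rmorphism E -> E1} of hE \o iE], j1; split.
- by move=> w; rewrite /= ej1 /= comm.
- pose f : {rmorphism K -> K1} := [the {rmorphism K -> K1} of hK \o iK].
  have uD : dsum (e%:M : 'M_1) (diagform m d) \in unitmx.
    by rewrite (@unit_dsum _ 1 m) unit_scalar // unit_diagform.
  have sD : subform (dsum (e%:M : 'M_1) (diagform m d)) q.
    exact: subform_trans (@subform_dsum _ 1 m 1 m _ _ _ _ (subform_refl _) s3) s1.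
  have := isotropic_subform _ (subform_map f sD); rewrite map_unitmx => /(_ uD).
  apply=> aD; have fe0 : f e != 0 by rewrite fmorph_eq0.
  have eg : hK g = f e * qf (map_mx f (diagform m d)) (map_mx hK x).
    rewrite map_mx_comp qf_map /g -scale_diagform map_mxZ qf_scale.
    by rewrite rmorphM.
  suff /aD : qf (map_mx f (dsum (e%:M : 'M_1) (diagform m d)))
      (row_mx (y / f e)%:M (map_mx hK x)) = 0.
    move=> e1; have := congr1 (fun w => rsubmx w) e1.
    rewrite row_mxKr linear0 => /eqP; rewrite map_mx_eq0 => /eqP x00.
    by move: (x0 m0); rewrite x00 eqxx.
  rewrite map_dsum qf_dsum map_scalar_mx.
  apply: (mulfI fe0); rewrite mulr0 mulrDr -eg /qf /bf -scalar_mxM tr_scalar_mx.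
  rewrite -scalar_mxM mxE eqxx mulr1n.
  transitivity (y ^+ 2 + hK g); first by field.
  by rewrite ey rmorphN addNr.
- move=> k a ha aX; rewrite map_mx_comp => nA.
  have := sq_dsum K idfun; rewrite map_mx_id // => /subform_trans; apply.
  exact: (isotropic_over_quadric_field c2 ha gK Hy aX nA).
- move=> k a ha aX; rewrite map_mx_comp => nA.
  apply: subform_trans (sq_dsum E j) _.
  apply: (isotropic_over_quadric_field c2E ha gE _ aX nA).
  by rewrite -rmorphN.
Qed.

(** * Enlarging the common part of two Pfister forms *)

(** Over the function field of the first Pfister form, the common part exceeds
half of an isotropic Pfister form, so it is isotropic, and so is the second
form.  The subform theorem applies with the value 1. *)
Lemma subform_of_big_common (K : fieldType) k s l x m (S : 'M[K]_m) :
  (2%:R : K) != 0 -> nonzero_upto k.+1 s -> nonzero_upto l x ->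
  anisotropic (pfister l x) -> S \in unitmx -> (pdim k < m)%N ->
  subform S (pfister k.+1 s) -> subform S (pfister l x) ->
  subform (pfister k.+1 s) (pfister l x).
Proof.
move=> c2 hs hx aX uS km sS sX.
have [v qv] := pfister_represents1 k.+1 s.
have gt1 : (1 < pdim k.+1)%N by rewrite -[1%N]/(pdim 0) ltn_pdim.
have [K1 [_ [iK [_ [_ [_ iso HX _]]]]]] := function_field_square
  idfun c2 gt1 (symmx_pfister _ _) (oner_neq0 _) qv.
rewrite -[pfister k.+1 s]scale1r; apply: HX => //.
move: iso; rewrite map_pfister => iso.
have uS1 : map_mx iK S \in unitmx by rewrite map_unitmx.
apply: (isotropic_subform uS1 (subform_map iK sX)).
apply: (isotropic_big_subform _ uS1 km _ iso); first exact: nonzero_upto_map.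
by rewrite -map_pfister; apply: subform_map.
Qed.

(** The form [A] is isometric to [e A1 + e R0], so a copy of [- e R1] lies in [e R0] by
cancellation.  A vector of [R1] together with its image in [R0] has value 0 in
[R0 + R1]. *)
Lemma common_complement_isotropic (L : fieldType) N (A : 'M[L]_N) i (R0 : 'M_i)
    n1 (A1 : 'M_n1) m1 (R1 : 'M_m1) e k (rho : 'M_k) :
  (2%:R : L) != 0 -> symmx R0 -> symmx A1 -> (0 < m1)%N -> e != 0 ->
  R0 \in unitmx -> R1 \in unitmx -> A1 \in unitmx ->
  anisotropic A -> subform (e *: A) A ->
  subform A (dsum R0 A1) -> subform (dsum R0 A1) A ->
  subform (dsum R0 R1) rho -> subform (e *: dsum A1 (- R1)) A -> ~ anisotropic rho.
Proof.
move=> c2 sR0 sA1 m0 e0 uR0 uR1 uA1 aA eA A01 A10 R01 s1.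
have A_eA : subform A (e *: A).
  apply: subform_rev => //; rewrite unit_scale //; exact: anisotropic_unit.
have eq1 : e *: dsum A1 R0 = dsum (e *: A1) (e *: R0) by rewrite scale_dsum.
have u10 : e *: dsum A1 R0 \in unitmx by rewrite unit_scale // unit_dsum uA1.
have sub10 : subform (e *: dsum A1 R0) A.
  apply: subform_trans eA; apply: subform_scale.
  exact: subform_trans (subform_dsumC _ _) A10.
have a10 := anisotropic_subform u10 sub10 aA.
have s2 : subform (e *: dsum A1 (- R1)) (e *: dsum A1 R0).
  apply: subform_trans s1 (subform_trans A_eA _); apply: subform_scale.
  exact: subform_trans A01 (subform_dsumC _ _).
rewrite !scale_dsum in a10 s2.
have s3 := witt_cancellation c2 (symmx_scale e sA1) (symmx_scale e sR0) a10 s2.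
have [P eP] := subform_scale e^-1 s3.
rewrite !scalerA mulVf // !scale1r in eP.
have uD : dsum R0 R1 \in unitmx by rewrite unit_dsum uR0.
apply: (isotropic_subform uD R01) => aD.
pose y : 'rV[L]_m1 := const_mx 1.
have /aD e1 : qf (dsum R0 R1) (row_mx (y *m P) y) = 0.
  by rewrite qf_dsum qf_mul eP qf_opp addNr.
have := congr1 (fun w => rsubmx w) e1; rewrite row_mxKr linear0 => /rowP.
move/(_ (Ordinal m0)); rewrite !mxE => /eqP.
by rewrite oner_eq0.
Qed.

(** The function field of the quadric [q = A1 - R1], where [R0 + A1] and [R0 + R1] are
the two given Pfister forms; [S] is [e A1] for a value [e] of [A1].  The conclusions
are the growth of the common part, the effect of the field on Pfister forms over
[K], and its effect on Pfister forms over [E]. *)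
Lemma common_part_field (K E : fieldType) (j : {rmorphism K -> E}) n r a s i
    (R0 : 'M[K]_i) :
  (2%:R : K) != 0 -> (r < n)%N -> (i < pdim r)%N ->
  nonzero_upto n a -> nonzero_upto r s ->
  anisotropic (pfister n a) -> anisotropic (pfister r s) ->
  R0 \in unitmx -> subform R0 (pfister r s) -> subform R0 (pfister n a) ->
  exists n1 (S : 'M[K]_n1), [/\ (n1 + i)%N = pdim n, S \in unitmx, subform S (pfister n a)
   & exists (K1 E1 : fieldType) (iK : {rmorphism K -> K1}) (iE : {rmorphism E -> E1})
     (j1 : {rmorphism K1 -> E1}),
   [/\ forall x, j1 (iK x) = iE (j x),
      anisotropic (pfister n (iK \o a)) -> anisotropic (pfister r (iK \o s)) ->
        exists R1 : 'M[K1]_i.+1, [/\ R1 \in unitmx,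
          subform R1 (pfister r (iK \o s)) & subform R1 (pfister n (iK \o a))],
      anisotropic (pfister n (iK \o a)) /\ (forall k x, nonzero_upto k x ->
        anisotropic (pfister k x) -> ~ anisotropic (pfister k (iK \o x)) ->
        subform S (pfister k x)),
      anisotropic (pfister n (j \o a)) -> anisotropic (pfister r (j \o s)) ->
        anisotropic (pfister n (iE \o (j \o a)))
    & forall k x, nonzero_upto k x -> anisotropic (pfister k x) ->
       ~ anisotropic (pfister k (iE \o x)) -> subform (map_mx j S) (pfister k x)]].
Proof.
move=> c2 rn ir ha hs aA arho uR0 R0rho R0A.
set A := pfister n a in aA R0A *; set rho := pfister r s in arho R0rho *.
have sA : symmx A := symmx_pfister n a; have srho : symmx rho := symmx_pfister r s.
have sR0 : symmx R0 := symmx_subform sA R0A.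
have [n1 [A1 [en1 sA1 A10 A01 aA1]]] := subform_complement sA uR0 R0A.
have [m1 [R1 [em1 sR1 R10 R01 aR1]]] := subform_complement srho uR0 R0rho.
have {}aA1 := aA1 aA; have {}aR1 := aR1 arho.
have uA1 := anisotropic_unit aA1; have uR1 := anisotropic_unit aR1.
have m0 : (0 < m1)%N by move: ir; rewrite -em1 -{1}[i]add0n ltn_add2r.
have n0 : (0 < n1)%N.
  by have := ltn_trans ir (ltn_pdim rn); rewrite -en1 -{1}[i]add0n ltn_add2r.
pose v : 'rV[K]_n1 := const_mx 1; pose e := qf A1 v.
have e0 : e != 0.
  apply/eqP => /aA1 /rowP/(_ (Ordinal n0)); rewrite !mxE => /eqP.
  by rewrite oner_eq0.
have eAA : subform (e *: A) A.
  apply: pfister_round_subform e0 _.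
  have [P eP] := subform_trans (subform_dsumr R0 A1) A10.
  by exists (v *m P); rewrite qf_mul eP.
have eA1A : subform (e *: A1) A.
  apply: subform_trans eAA; apply: subform_scale.
  exact: subform_trans (subform_dsumr R0 A1) A10.
pose q := dsum A1 (- R1).
have sq : symmx q by apply: symmx_dsum => //; apply: symmx_opp.
have qv : qf q (row_mx v 0) = e by rewrite qf_dsum qf0 addr0.
have gt1 : (1 < n1 + m1)%N by rewrite -(addn1 1) leq_add.
have [K1 [E1 [iK [iE [j1 [comm iso HK HE]]]]]] :=
  function_field_square j c2 gt1 sq e0 qv.
exists n1, (e *: A1); split=> //; first by rewrite unit_scale.
exists K1, E1, iK, iE, j1; split=> //.
- rewrite -!map_pfister -/A -/rho => aAK arhoK.
  case: (isotropicP (map_mx iK q)) => // -[z].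
  rewrite -[z]hsubmxK map_dsum map_mxN; move: (lsubmx z) (rsubmx z) => {}z y.
  rewrite qf_dsum qf_opp => zy0 /eqP; rewrite subr_eq0 => /eqP ezy.
  have uA1K : map_mx iK A1 \in unitmx by rewrite map_unitmx.
  have uR1K : map_mx iK R1 \in unitmx by rewrite map_unitmx.
  have aA1K : anisotropic (map_mx iK A1).
    apply: anisotropic_subform aAK => //; apply: subform_map.
    exact: subform_trans (subform_dsumr R0 A1) A10.
  have aR1K : anisotropic (map_mx iK R1).
    apply: anisotropic_subform arhoK => //; apply: subform_map.
    exact: subform_trans (subform_dsumr R0 R1) R10.
  pose c := qf (map_mx iK R1) y.
  have c0 : c != 0.
    apply: contraNneq zy0 => c0.
    by rewrite (aA1K z) ?ezy // (aR1K y) // row_mx0.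
  have common l (T : 'M_l) k (B : 'M_k) w : qf (map_mx iK T) w = c ->
      subform (dsum R0 T) B ->
      subform (dsum (c%:M : 'M_1) (map_mx iK R0)) (map_mx iK B).
    move=> qw sB; apply: subform_trans (subform_dsumC _ _) _.
    apply: subform_trans (subform_map iK sB); rewrite map_dsum.
    apply: subform_dsum; first exact: subform_refl.
    by exists w; apply: mulmx_line.
  exists (dsum (c%:M : 'M_1) (map_mx iK R0)); split.
  + by rewrite (@unit_dsum _ 1 i) unit_scalar // map_unitmx.
  + exact: (common _ _ _ _ y (erefl c) R10).
  + exact: (common _ _ _ _ z ezy A10).
- split; last first.
    move=> k x hx aX; rewrite -map_pfister => /(HK _ _ hx aX).
    apply: subform_trans; apply: subform_scale; exact: subform_dsuml.
  apply: contrapT; rewrite -map_pfister => /(HK _ _ ha aA) s1.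
  by apply: (common_complement_isotropic c2 sR0 sA1 m0 e0 uR0 uR1 uA1 aA eAA A01 A10 R10 s1).
- rewrite -!map_pfister -/A -/rho => aAE arhoE; apply: contrapT.
  have c2E := two_neq0_map j c2.
  have je0 : j e != 0 by rewrite fmorph_eq0.
  rewrite map_pfister -map_pfister => nA.
  have := HE n (j \o a); rewrite -!map_pfister -/A.
  move/(_ (nonzero_upto_map j ha) aAE nA); rewrite /q map_dsum map_mxN => s1.
  have mu k (B : 'M[K]_k) : B \in unitmx -> map_mx j B \in unitmx by rewrite map_unitmx.
  have eAAE : subform (j e *: map_mx j A) (map_mx j A).
    by rewrite -map_mxZ; apply: subform_map.
  have A01E := subform_map j A01; have A10E := subform_map j A10.
  have R10E := subform_map j R10; rewrite !map_dsum in A01E A10E R10E.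
  by apply: (common_complement_isotropic c2E (symmx_map j sR0) (symmx_map j sA1)
    m0 je0 (mu _ _ uR0) (mu _ _ uR1) (mu _ _ uA1) aAE eAAE A01E A10E R10E s1).
- move=> k x hx aX; rewrite -map_pfister => /(HE _ _ hx aX).
  rewrite map_mxZ; apply: subform_trans; apply: subform_scale.
  by rewrite map_dsum; apply: subform_dsuml.
Qed.

(** [a], [b], [c] are the slots of phi, psi, omega.  The condition is stated for slots
because it is carried along through all the field extensions. *)
Definition separated (K : fieldType) p (a b c : nat -> K) : Prop :=
  [/\ nonzero_upto p.+2 a, nonzero_upto p.+2 b & nonzero_upto p.+1 c] /\
  [/\ anisotropic (pfister p.+2 a), anisotropic (pfister p.+2 b),
      subform (pfister p.+1 c) (pfister p.+2 a)
    & ~ subform (pfister p.+1 c) (pfister p.+2 b)].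

(** The function field of omega.  If psi became isotropic it would contain
omega; a form of smaller dimension cannot contain omega. *)
Lemma separating_field (K : fieldType) p (a b c : nat -> K) :
  (2%:R : K) != 0 -> separated p a b c ->
  exists (E : fieldType) (j : {rmorphism K -> E}),
  [/\ ~ anisotropic (pfister p.+1 (j \o c)), anisotropic (pfister p.+2 (j \o b))
    & forall r s, (r <= p)%N -> nonzero_upto r s -> anisotropic (pfister r s) ->
      anisotropic (pfister r (j \o s))].
Proof.
move=> c2 [[ha hb hc] [aa ab sca ncb]].
have [v qv] := pfister_represents1 p.+1 c.
have gt1 : (1 < pdim p.+1)%N by rewrite -[1%N]/(pdim 0) ltn_pdim.
have [E [_ [j [_ [_ [_ iso H _]]]]]] := function_field_square
  idfun c2 gt1 (symmx_pfister _ _) (oner_neq0 _) qv.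
exists E, j; split.
- by rewrite -map_pfister.
- apply: contrapT; rewrite -map_pfister => /(H _ _ hb ab).
  by rewrite scale1r.
- move=> r s rp hs as_; apply: contrapT; rewrite -map_pfister => /(H _ _ hs as_).
  rewrite scale1r => /(subform_leq (unit_pfister hc)).
  by rewrite leqNgt ltn_pdim.
Qed.

(** The form with slots [s] lies in one of phi and psi, and is to be moved into
the other one, with slots [A]; the boolean [sw] chooses which. *)
Lemma common_part_step (sw : bool) (K : fieldType) p (a b c : nat -> K) r s i
    (R0 : 'M[K]_i) :
  let A := if sw then a else b in let B := if sw then b else a in
  (2%:R : K) != 0 -> separated p a b c -> (r <= p)%N -> (i < pdim r)%N ->
  nonzero_upto r s -> subform (pfister r s) (pfister p.+2 B) ->
  R0 \in unitmx -> subform R0 (pfister r s) -> subform R0 (pfister p.+2 A) ->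
  exists (L : fieldType) (f : {rmorphism K -> L}),
    separated p (f \o a) (f \o b) (f \o c) /\
    exists R1 : 'M[L]_i.+1, [/\ R1 \in unitmx, subform R1 (pfister r (f \o s))
      & subform R1 (pfister p.+2 (f \o A))].
Proof.
move=> A B c2 sep rp ir hs sB uR0 R0s R0A.
have [E [j [wE psiE rhoE]]] := separating_field c2 sep.
have [[ha hb hc] [aa ab sca ncb]] := sep.
have hA : nonzero_upto p.+2 A by rewrite /A; case: (sw).
have aA : anisotropic (pfister p.+2 A) by rewrite /A; case: (sw).
have aB : anisotropic (pfister p.+2 B) by rewrite /B; case: (sw).
have as_ := anisotropic_subform (unit_pfister hs) sB aB.
have rp2 : (r < p.+2)%N by rewrite ltnW.
have [n1 [S [en1 uS SA [K1 [E1 [iK [iE [j1 [comm grow [AK HK] AE HE]]]]]]]]] :=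
  common_part_field j c2 rp2 ir hA hs aA as_ uR0 R0s R0A.
have bigS : (pdim p.+1 < n1)%N.
  have := leq_trans ir (leq_pdim rp); have := ltn_pdim (ltnSn p).
  by move: en1 => /=; lia.
have nab : ~ (subform S (pfister p.+2 a) /\ subform S (pfister p.+2 b)).
  move=> [Sa Sb]; apply: ncb; apply: subform_trans sca _.
  exact: subform_of_big_common bigS Sa Sb.
have wa : ~ anisotropic (pfister p.+2 (j \o a)).
  apply: isotropic_subform wE; last exact: subform_pfister_map.
  by apply: unit_pfister; apply: nonzero_upto_map.
have [aK bK bE] : [/\ anisotropic (pfister p.+2 (iK \o a)),
    anisotropic (pfister p.+2 (iK \o b))
  & anisotropic (pfister p.+2 (iE \o (j \o b)))].
  case: (sw) @A @B hA aA aB SA sB AK AE nab {R0A grow} => A B.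
    move=> _ _ _ Sa sB aK _ nab; split; first exact: aK.
      apply: contrapT => nb; apply: nab; split; first exact: Sa.
      exact: HK p.+2 b hb ab nb.
    apply: contrapT => nb.
    have Sb := HE p.+2 (j \o b) (nonzero_upto_map j hb) psiE nb.
    have uSE : map_mx j S \in unitmx by rewrite map_unitmx.
    apply: (isotropic_subform uSE Sb) psiE.
    apply: (isotropic_big_subform _ uSE bigS _ wa).
      exact: nonzero_upto_map.
    by rewrite -map_pfister; apply: subform_map.
  move=> _ _ _ Sb sB bK bE nab; split; [|exact: bK|].
    apply: contrapT => na; apply: nab; split; last exact: Sb.
    exact: HK p.+2 a ha aa na.
  by apply: bE; [exact: psiE|apply: rhoE].
exists K1, iK; split.
  split; first by split; apply: nonzero_upto_map.
  split; [exact: aK|exact: bK|exact: subform_pfister_map|].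
  move=> cb0; have cb := subform_pfister_map j1 cb0.
  have ec k (x : nat -> K) : pfister k (j1 \o (iK \o x)) = pfister k (iE \o (j \o x)).
    by apply: eq_pfister => l _; rewrite /= comm.
  rewrite !ec in cb.
  have hcE := nonzero_upto_map iE (nonzero_upto_map j hc).
  apply: (isotropic_subform (unit_pfister hcE) cb) bE.
  by rewrite -map_pfister => /anisotropic_map.
apply: grow; first exact: AK.
apply: anisotropic_subform (subform_pfister_map iK sB) _.
  by apply: unit_pfister; apply: nonzero_upto_map.
by rewrite /B; case: (sw).
Qed.

Lemma factor_becomes_common (sw : bool) (K : fieldType) p (a b c : nat -> K) r s :
  let A := if sw then a else b in let B := if sw then b else a in
  (2%:R : K) != 0 -> separated p a b c -> (r <= p)%N ->
  nonzero_upto r s -> subform (pfister r s) (pfister p.+2 B) ->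
  exists (L : fieldType) (f : {rmorphism K -> L}),
    separated p (f \o a) (f \o b) (f \o c) /\
    subform (pfister r (f \o s)) (pfister p.+2 (f \o A)).
Proof.
move=> A B c2 sep rp hs sB.
suff /(_ _ (leqnn _)) [L [f [sepL [R1 [uR1 R1s R1A]]]]] :
  forall i, (i <= pdim r)%N -> exists (L : fieldType) (f : {rmorphism K -> L}),
    separated p (f \o a) (f \o b) (f \o c) /\
    exists R1 : 'M[L]_i, [/\ R1 \in unitmx, subform R1 (pfister r (f \o s))
      & subform R1 (pfister p.+2 (f \o A))].
  exists L, f; split=> //; apply: subform_trans R1A.
  exact: subform_rev R1s.
elim=> [_|i IH ir].
  exists K, idfun; split=> //; exists 0; split.
  - by rewrite unitmxE det_mx00 unitr1.
  - by exists 0; apply/matrixP=> -[].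
  - by exists 0; apply/matrixP=> -[].
have [L [f [sepL [R1 [uR1 R1s R1A]]]]] := IH (ltnW ir).
have swf : (if sw then f \o a else f \o b) = f \o A by rewrite /A; case: (sw).
have [|||L1 [f1 [sepL1 H]]] := @common_part_step sw L p _ _ _ r (f \o s) i R1
  (two_neq0_map f c2) sepL rp ir _ _ uR1 R1s.
- exact: nonzero_upto_map.
- have -> : (if sw then f \o b else f \o a) = f \o B by rewrite /B; case: (sw).
  exact: subform_pfister_map.
- by rewrite swf.
rewrite swf in H.
by exists L1, [the {rmorphism K -> L1} of f1 \o f].
Qed.

(** * Ultraproducts of fields *)

Section Ultraproduct.
Variables (I : Type) (U : set_system I) (UU : UltraFilter U) (K : I -> fieldType).

Local Open Scope quotient_scope.
Local Open Scope classical_set_scope.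

Definition ultra_equiv (x y : forall i, K i) : bool := `[< U [set i | x i = y i] >].

Lemma ultra_equiv_refl : reflexive ultra_equiv.
Proof.
move=> x; apply/asboolP; have -> : [set i | x i = x i] = [set: I] by apply/seteqP.
exact: filterT.
Qed.

Lemma ultra_equiv_sym : symmetric ultra_equiv.
Proof.
by move=> x y; apply/asboolP/asboolP; apply: filterS => i /= ->.
Qed.

Lemma ultra_equiv_trans : transitive ultra_equiv.
Proof.
move=> y x z /asboolP xy /asboolP yz; apply/asboolP.
by apply: filterS2 xy yz => i /= -> ->.
Qed.

Canonical ultra_equivRel :=
  EquivRel ultra_equiv ultra_equiv_refl ultra_equiv_sym ultra_equiv_trans.

Definition ultraproduct : Type := {eq_quot ultra_equiv}.
Local Notation W := ultraproduct.

HB.instance Definition _ := Choice.copy W {eq_quot ultra_equiv}.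

Definition ultra_class (x : forall i, K i) : W := \pi_({eq_quot ultra_equiv}) x.
Definition ultra_repr (w : W) : forall i, K i := repr (w : {eq_quot ultra_equiv}).

Lemma ultra_reprK w : ultra_class (ultra_repr w) = w.
Proof. exact: reprK. Qed.

Lemma ultra_classP x y :
  ultra_class x = ultra_class y <-> U [set i | x i = y i].
Proof. by split=> [/eqmodP/asboolP|/asboolP xy]; last apply/eqmodP. Qed.

Lemma ultra_class_ext x y : (forall i, x i = y i) -> ultra_class x = ultra_class y.
Proof.
by move=> xy; apply/ultra_classP; apply: filterS (filterT : U setT) => i _ /=.
Qed.

Lemma ultra_reprP x : U [set i | ultra_repr (ultra_class x) i = x i].
Proof. by apply/ultra_classP; rewrite ultra_reprK. Qed.

Definition ultra_zero : W := ultra_class (fun=> 0).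
Definition ultra_one : W := ultra_class (fun=> 1).
Definition ultra_opp (x : W) : W := ultra_class (fun i => - ultra_repr x i).
Definition ultra_inv (x : W) : W := ultra_class (fun i => (ultra_repr x i)^-1).
Definition ultra_add (x y : W) : W :=
  ultra_class (fun i => ultra_repr x i + ultra_repr y i).
Definition ultra_mul (x y : W) : W :=
  ultra_class (fun i => ultra_repr x i * ultra_repr y i).

Lemma ultra_oppE x : ultra_opp (ultra_class x) = ultra_class (fun i => - x i).
Proof. by apply/ultra_classP; apply: filterS (ultra_reprP x) => i /= ->. Qed.

Lemma ultra_invE x : ultra_inv (ultra_class x) = ultra_class (fun i => (x i)^-1).
Proof. by apply/ultra_classP; apply: filterS (ultra_reprP x) => i /= ->. Qed.

Lemma ultra_addE x y :
  ultra_add (ultra_class x) (ultra_class y) = ultra_class (fun i => x i + y i).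
Proof.
apply/ultra_classP; apply: filterS2 (ultra_reprP x) (ultra_reprP y).
by move=> i /= -> ->.
Qed.

Lemma ultra_mulE x y :
  ultra_mul (ultra_class x) (ultra_class y) = ultra_class (fun i => x i * y i).
Proof.
apply/ultra_classP; apply: filterS2 (ultra_reprP x) (ultra_reprP y).
by move=> i /= -> ->.
Qed.

Lemma ultra_ind (P : W -> Prop) : (forall x, P (ultra_class x)) -> forall w, P w.
Proof. by move=> Px w; rewrite -[w]ultra_reprK. Qed.

Lemma ultra_addA : associative ultra_add.
Proof.
elim/ultra_ind=> x; elim/ultra_ind=> y; elim/ultra_ind=> z.
by rewrite !ultra_addE; apply: ultra_class_ext => i; rewrite addrA.
Qed.

Lemma ultra_addC : commutative ultra_add.
Proof.
elim/ultra_ind=> x; elim/ultra_ind=> y.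
by rewrite !ultra_addE; apply: ultra_class_ext => i; rewrite addrC.
Qed.

Lemma ultra_add0 : left_id ultra_zero ultra_add.
Proof.
elim/ultra_ind=> x.
by rewrite !ultra_addE; apply: ultra_class_ext => i; rewrite add0r.
Qed.

Lemma ultra_addN : left_inverse ultra_zero ultra_opp ultra_add.
Proof.
elim/ultra_ind=> x; rewrite ultra_oppE ultra_addE.
by apply: ultra_class_ext => i; rewrite addNr.
Qed.

HB.instance Definition _ := GRing.isZmodule.Build W
  ultra_addA ultra_addC ultra_add0 ultra_addN.

Lemma ultra_mulA : associative ultra_mul.
Proof.
elim/ultra_ind=> x; elim/ultra_ind=> y; elim/ultra_ind=> z.
by rewrite !ultra_mulE; apply: ultra_class_ext => i; rewrite mulrA.
Qed.

Lemma ultra_mulC : commutative ultra_mul.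
Proof.
elim/ultra_ind=> x; elim/ultra_ind=> y.
by rewrite !ultra_mulE; apply: ultra_class_ext => i; rewrite mulrC.
Qed.

Lemma ultra_mul1 : left_id ultra_one ultra_mul.
Proof.
elim/ultra_ind=> x.
by rewrite !ultra_mulE; apply: ultra_class_ext => i; rewrite mul1r.
Qed.

Lemma ultra_mulDl : left_distributive ultra_mul ultra_add.
Proof.
elim/ultra_ind=> x; elim/ultra_ind=> y; elim/ultra_ind=> z.
rewrite !(ultra_mulE, ultra_addE); apply: ultra_class_ext => i.
by rewrite mulrDl.
Qed.

Lemma ultra_one_neq0 : ultra_one != ultra_zero.
Proof.
apply/eqP => /ultra_classP /filter_ex [i] /= /eqP.
by rewrite oner_eq0.
Qed.

HB.instance Definition _ := GRing.Zmodule_isComNzRing.Build W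
  ultra_mulA ultra_mulC ultra_mul1 ultra_mulDl ultra_one_neq0.

Lemma ultra_mulV (x : W) : x != 0 -> ultra_inv x * x = 1.
Proof.
elim/ultra_ind: x => x x0; rewrite ultra_invE [LHS]ultra_mulE.
apply/ultra_classP.
case: (in_ultra_setVsetC [set i | x i = 0] UU) => [Ux0|].
  by case/eqP: x0; apply/ultra_classP.
by apply: filterS => i /= /eqP xi; rewrite mulVf.
Qed.

Lemma ultra_inv0 : ultra_inv 0 = 0.
Proof. by rewrite ultra_invE; apply: ultra_class_ext => i; rewrite invr0. Qed.

HB.instance Definition _ := GRing.ComNzRing_isField.Build W ultra_mulV ultra_inv0.

Lemma ultra_sum (J : Type) (r : seq J) (x : J -> forall i, K i) :
  ultra_class (fun i => \sum_(j <- r) x j i) = \sum_(j <- r) ultra_class (x j).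
Proof.
elim: r => [|j r IH].
  by rewrite big_nil; apply: ultra_class_ext => i; rewrite big_nil.
rewrite big_cons -IH [RHS]ultra_addE.
by apply: ultra_class_ext => i; rewrite big_cons.
Qed.

Definition mx_class m n (A : forall i, 'M[K i]_(m, n)) : 'M[W]_(m, n) :=
  \matrix_(a, b) ultra_class (fun i => A i a b).
Definition mx_repr m n (M : 'M[W]_(m, n)) i : 'M[K i]_(m, n) :=
  \matrix_(a, b) ultra_repr (M a b) i.

Lemma mx_reprK m n (M : 'M[W]_(m, n)) : mx_class (mx_repr M) = M.
Proof.
apply/matrixP => a b; rewrite mxE -[RHS]ultra_reprK.
by apply: ultra_class_ext => i; rewrite mxE.
Qed.

Lemma mx_classP m n (A B : forall i, 'M[K i]_(m, n)) :
  mx_class A = mx_class B <-> U [set i | A i = B i].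
Proof.
split=> [/matrixP AB|UAB]; last first.
  apply/matrixP=> a b; rewrite !mxE; apply/ultra_classP.
  by apply: filterS UAB => i /= ->.
have Uab a b : U [set i | A i a b = B i a b].
  by apply/ultra_classP; have := AB a b; rewrite !mxE.
have Uall : U [set i | forall a b, A i a b = B i a b].
  exact: filter_forall (fun a => filter_forall _ (Uab a)).
by apply: filterS Uall => i /= e; apply/matrixP => a b; apply: e.
Qed.

Lemma mx_classM m n p (A : forall i, 'M[K i]_(m, n)) (B : forall i, 'M[K i]_(n, p)) :
  mx_class (fun i => A i *m B i) = mx_class A *m mx_class B.
Proof.
apply/matrixP => a b; rewrite !mxE.
rewrite (ultra_class_ext (fun i => mxE _ _ a b)) ultra_sum.
by apply: eq_bigr => c _; rewrite !mxE [RHS]ultra_mulE.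
Qed.

Lemma mx_class_tr m n (A : forall i, 'M[K i]_(m, n)) :
  mx_class (fun i => (A i)^T) = (mx_class A)^T.
Proof.
by apply/matrixP => a b; rewrite !mxE; apply: ultra_class_ext => i; rewrite mxE.
Qed.

(** An embedding over the ultraproduct is a class of matrices; conversely a choice
of embeddings in almost all factors, completed arbitrarily, defines one. *)
Lemma ultra_subform k n (S : forall i, 'M[K i]_k) (M : forall i, 'M[K i]_n) :
  subform (mx_class S) (mx_class M) <-> U [set i | subform (S i) (M i)].
Proof.
split=> [[P]|USM].
  rewrite -[P]mx_reprK -mx_class_tr -!mx_classM => /mx_classP.
  by apply: filterS => i /= e; exists (mx_repr P i).
have H i : exists P : 'M[K i]_(k, n), subform (S i) (M i) -> P *m M i *m P^T = S i.
  have [[P eP]|nS] := pselect (subform (S i) (M i)); first by exists P.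
  by exists 0.
pose P i := projT1 (cid (H i)).
exists (mx_class P); rewrite -mx_class_tr -!mx_classM; apply/mx_classP.
by apply: filterS USM => i /= SM; apply: (projT2 (cid (H i))).
Qed.

Lemma ultra_anisotropic n (M : forall i, 'M[K i]_n) :
  U [set i | anisotropic (M i)] -> anisotropic (mx_class M).
Proof.
move=> UM x; rewrite -[x]mx_reprK /qf /bf -mx_class_tr -!mx_classM mxE.
move=> /ultra_classP Ux; have -> : 0 = mx_class (fun i => 0 : 'rV[K i]_n).
  by apply/matrixP=> a b; rewrite !mxE; apply: ultra_class_ext => i; rewrite mxE.
by apply/mx_classP; apply: filterS2 UM Ux => i /= aM qx; apply: aM.
Qed.

Lemma ultra_diagonal (F : fieldType) (f : forall i, {rmorphism F -> K i}) :
  exists g : {rmorphism F -> W}, forall x, g x = ultra_class (fun i => f i x).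
Proof.
pose g x : W := ultra_class (fun i => f i x).
have gB : zmod_morphism g.
  move=> x y; rewrite /g -[- ultra_class _]/(ultra_opp _) ultra_oppE [RHS]ultra_addE.
  by apply: ultra_class_ext => i; rewrite rmorphB.
have gM : monoid_morphism g.
  split=> [|x y]; first by apply: ultra_class_ext => i; rewrite rmorph1.
  by rewrite [RHS]ultra_mulE; apply: ultra_class_ext => i; rewrite rmorphM.
pose G1 := GRing.isZmodMorphism.Build _ _ g gB.
pose G2 := GRing.isMonoidMorphism.Build _ _ g gM.
pose G : {rmorphism F -> W} := HB.pack g G1 G2.
by exists G.
Qed.

End Ultraproduct.

(** * Treating all forms over a given field *)

Lemma pfister_mx_class (I : Type) (U : set_system I) (UU : UltraFilter U)
    (K : I -> fieldType) (F : fieldType) (f : forall i, {rmorphism F -> K i})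
    (g : {rmorphism F -> ultraproduct UU K}) k a :
  (forall x, g x = ultra_class UU (fun i => f i x)) ->
  pfister k (g \o a) = mx_class UU (fun i => pfister k (f i \o a)).
Proof.
move=> gE; rewrite -map_pfister; apply/matrixP=> u v; rewrite !mxE gE.
by apply: ultra_class_ext => i; rewrite -map_pfister mxE.
Qed.

Definition extension (K : fieldType) : Type :=
  {L : fieldType & {rmorphism K -> L}}.
Definition Extension (K L : fieldType) (f : {rmorphism K -> L}) : extension K :=
  existT (fun L : fieldType => {rmorphism K -> L}) L f.

Section Linking.
Variables (p r : nat).
Hypothesis rp : (r <= p)%N.

Definition links (K L : fieldType) (f : {rmorphism K -> L}) (a b s : nat -> K) : Prop :=
  [/\ subform (pfister r s) (pfister p.+2 a) ->
        subform (pfister r (f \o s)) (pfister p.+2 (f \o b))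
    & subform (pfister r s) (pfister p.+2 b) ->
        subform (pfister r (f \o s)) (pfister p.+2 (f \o a))].

Lemma link_one_form (K : fieldType) (a b c s : nat -> K) :
  (2%:R : K) != 0 -> separated p a b c -> nonzero_upto r s ->
  exists (L : fieldType) (f : {rmorphism K -> L}),
    separated p (f \o a) (f \o b) (f \o c) /\ links f a b s.
Proof.
move=> c2 sep hs.
have [sa|nsa] := pselect (subform (pfister r s) (pfister p.+2 a)).
  have [L [f [sepL sbL]]] := @factor_becomes_common false K p a b c r s c2 sep rp hs sa.
  exists L, f; split; [exact: sepL|split=> [_|_]; first exact: sbL].
  exact: (subform_pfister_map f sa).
have [sb|nsb] := pselect (subform (pfister r s) (pfister p.+2 b)).
  have [L [f [sepL saL]]] := @factor_becomes_common true K p a b c r s c2 sep rp hs sb.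
  exists L, f; split; [exact: sepL|split=> [_|_]; last exact: saL].
  exact: (subform_pfister_map f sb).
exists K, idfun; split; first exact: sep.
by split=> h; [case: (nsa h)|case: (nsb h)].
Qed.

Lemma link_finitely_many (K : fieldType) (a b c : nat -> K) (l : seq (nat -> K)) :
  (2%:R : K) != 0 -> separated p a b c ->
  exists X : extension K,
    separated p (projT2 X \o a) (projT2 X \o b) (projT2 X \o c) /\
    forall s, List.In s l -> nonzero_upto r s -> links (projT2 X) a b s.
Proof.
move=> c2 sep; elim: l => [|s l [[L f] [/= sepL Hf]]].
  by exists (Extension idfun).
have c2L := two_neq0_map f c2.
have [hs|nhs] := pselect (nonzero_upto r s); last first.
  exists (Extension f); split=> // s' [<- //|]; exact: Hf.
have [L1 [f1 [sep1 [l1 l2]]]] := link_one_form c2L sepL (nonzero_upto_map f hs).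
exists (@Extension K L1 [the {rmorphism K -> L1} of f1 \o f]); split=> //= s' [<- _|s'l hs'].
  split=> h; [apply: l1|apply: l2]; exact: subform_pfister_map.
have [h1 h2] := Hf _ s'l hs'.
by split=> h; [exact: (subform_pfister_map f1 (h1 h))|exact: (subform_pfister_map f1 (h2 h))].
Qed.

Local Open Scope classical_set_scope.

(** A fixed form belongs to almost all finite lists of forms, for an ultrafilter
containing the sets of lists that extend a given one.  Being a subform and being
anisotropic pass to the ultraproduct. *)
Lemma link_all_forms (K : fieldType) (a b c : nat -> K) :
  (2%:R : K) != 0 -> separated p a b c ->
  exists X : extension K,
    separated p (projT2 X \o a) (projT2 X \o b) (projT2 X \o c) /\
    forall s, nonzero_upto r s -> links (projT2 X) a b s.
Proof.
move=> c2 sep.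
pose X l := projT1 (cid (link_finitely_many l c2 sep)).
have Xsep l : separated p (projT2 (X l) \o a) (projT2 (X l) \o b) (projT2 (X l) \o c).
  by have [] := projT2 (cid (link_finitely_many l c2 sep)).
have Xlinks l s : List.In s l -> nonzero_upto r s -> links (projT2 (X l)) a b s.
  by have [_] := projT2 (cid (link_finitely_many l c2 sep)); apply.
pose G : set_system (seq (nat -> K)) :=
  [set A | exists l0, forall l, (forall s, List.In s l0 -> List.In s l) -> A l].
have GP : ProperFilter G.
  split; first by case=> l0 /(_ l0); apply.
  split.
  - by exists [::].
  - move=> A B [l1 H1] [l2 H2]; exists (l1 ++ l2) => l Hl; split.
      by apply: H1 => s sl; apply: Hl; apply/List.in_app_iff; left.
    by apply: H2 => s sl; apply: Hl; apply/List.in_app_iff; right.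
  - by move=> A B AB [l0 H]; exists l0 => l /H; apply: AB.
have [U [UU GU]] := ultraFilterLemma GP.
pose f l : {rmorphism K -> projT1 (X l)} := projT2 (X l).
have [g gE] := ultra_diagonal UU f.
have pE k x : pfister k (g \o x) = mx_class UU (fun l => pfister k (f l \o x)).
  exact: pfister_mx_class.
have Uall (P : seq (nat -> K) -> Prop) : (forall l, P l) -> U [set l | P l].
  by move=> Pl; apply: filterS (filterT : U setT) => l _ /=.
exists (Extension g) => /=; split.
  have [[ha hb hc] _] := sep.
  split; first by split; apply: nonzero_upto_map.
  rewrite !pE; split.
  - by apply: ultra_anisotropic; apply: Uall => l; have [_ [h _ _ _]] := Xsep l; exact: h.
  - by apply: ultra_anisotropic; apply: Uall => l; have [_ [_ h _ _]] := Xsep l; exact: h.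
  - by apply/ultra_subform; apply: Uall => l; have [_ [_ _ h _]] := Xsep l; exact: h.
  - by move=> /ultra_subform /filter_ex [l sl]; have [_ [_ _ _ h]] := Xsep l; exact: h.
move=> s hs.
have Us : U [set l | List.In s l].
  by apply: GU; exists [:: s] => l; apply; left.
rewrite /links !pE; split=> h; apply/ultra_subform; apply: filterS Us => l /= sl.
  by have [H _] := Xlinks l s sl hs; exact: (H h).
by have [_ H] := Xlinks l s sl hs; exact: (H h).
Qed.

End Linking.

(** * Direct limits of towers of fields *)

Section Subfield.
Variables (W : fieldType) (S : W -> Prop).
Hypotheses (S1 : S 1) (SB : forall x y, S x -> S y -> S (x - y))
  (SV : forall x y, S x -> S y -> S (x / y)).

Definition subfield_pred : {pred W} := fun w => `[< S w >].

Lemma subfield_pred_closed : divring_closed subfield_pred.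
Proof.
split; first exact/asboolP.
  by move=> x y /asboolP Sx /asboolP Sy; apply/asboolP; apply: SB.
by move=> x y /asboolP Sx /asboolP Sy; apply/asboolP; apply: SV.
Qed.

HB.instance Definition _ :=
  GRing.isDivringClosed.Build W subfield_pred subfield_pred_closed.

Definition subfield_type : Type := {w : W | w \in subfield_pred}.
HB.instance Definition _ := SubChoice.on subfield_type.
HB.instance Definition _ := [SubChoice_isSubIntegralDomain of subfield_type by <:].
HB.instance Definition _ := [SubIntegralDomain_isSubField of subfield_type by <:].

Lemma subfield_exists :
  exists (L : fieldType) (e : {rmorphism L -> W}), forall w, S w <-> exists x, e x = w.
Proof.
exists subfield_type, [the {rmorphism subfield_type -> W} of val] => w; split.
  by move=> /asboolP Sw; exists (exist _ w Sw).
by move=> [x <-]; apply/asboolP; apply: (valP x).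
Qed.

End Subfield.

Lemma rmorphism_factor (K L W : fieldType) (e : {rmorphism L -> W})
    (f : {rmorphism K -> W}) :
  (forall x, exists y, e y = f x) ->
  exists g : {rmorphism K -> L}, forall x, e (g x) = f x.
Proof.
move=> /choice [g eg]; have inje := fmorph_inj e.
have gB : zmod_morphism g.
  by move=> x y; apply: inje; rewrite rmorphB !eg rmorphB.
have gM : monoid_morphism g.
  split=> [|x y]; apply: inje; rewrite ?rmorphM !eg ?rmorph1 //.
  by rewrite rmorphM.
pose G1 := GRing.isZmodMorphism.Build _ _ g gB.
pose G2 := GRing.isMonoidMorphism.Build _ _ g gM.
pose G : {rmorphism K -> L} := HB.pack g G1 G2.
by exists G.
Qed.

Definition coherent (K : nat -> fieldType) (t : forall n, {rmorphism K n -> K n.+1})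
    (n : nat) (x : forall m, K m) : Prop :=
  forall m, (n <= m)%N -> x m.+1 = t m (x m).

(** By induction on [n], for all towers at once: a coherent sequence of the tower
without its first field is extended by 0 in front. *)
Lemma coherent_extension n : forall (K : nat -> fieldType)
  (t : forall n, {rmorphism K n -> K n.+1}) (y : K n),
  exists2 x, x n = y & coherent t n x.
Proof.
elim: n => [|n IH] K t y.
  by exists (nat_rect (fun m => K m) y (fun m z => t m z)).
have [x xn xc] := IH (fun m => K m.+1) (fun m => t m.+1) y.
exists (fun m => match m return K m with 0 => 0 | m'.+1 => x m' end) => //.
by case=> // m nm; apply: xc.
Qed.

Lemma coherent_unique (K : nat -> fieldType) t n (x y : forall m, K m) :
  coherent t n x -> coherent t n y -> x n = y n ->
  forall m, (n <= m)%N -> x m = y m.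
Proof.
move=> xc yc xyn; elim=> [|m IH].
  by rewrite leqn0 => /eqP <-.
by rewrite leq_eqVlt => /orP[/eqP <- //|nm]; rewrite xc // yc // IH.
Qed.

Lemma limit_push (K : nat -> fieldType) (t : forall n, {rmorphism K n -> K n.+1})
    (L : fieldType) (e : forall n, {rmorphism K n -> L}) :
  (forall n x, e n.+1 (t n x) = e n x) ->
  forall n m x, (n <= m)%N -> exists y, e m y = e n x.
Proof.
move=> et n m x; elim: m => [|m IH].
  by rewrite leqn0 => /eqP n0; subst n; exists x.
rewrite leq_eqVlt => /orP[/eqP nm|/IH [y <-]]; first by subst n; exists x.
by exists (t m y); rewrite et.
Qed.

Section DirectLimit.
Variables (K : nat -> fieldType) (t : forall n, {rmorphism K n -> K n.+1}).

Local Open Scope classical_set_scope.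

(** Coherent sequences with the same term of index [n] agree from there on, hence
have the same class for an ultrafilter containing all final segments. *)
Lemma coherent_embedding (U : set_system nat) (UU : UltraFilter U) :
  \oo `<=` U -> forall n, exists e : {rmorphism K n -> ultraproduct UU K},
    forall x, coherent t n x -> e (x n) = ultra_class UU x.
Proof.
move=> Uoo n.
have H y : exists w : ultraproduct UU K, forall x, coherent t n x -> x n = y ->
    w = ultra_class UU x.
  have [x xn xc] := coherent_extension t y.
  exists (ultra_class UU x) => x' xc' xn'; apply/ultra_classP; apply: Uoo.
  exists n => // m /= nm; apply: coherent_unique xc xc' _ _ nm.
  by rewrite xn xn'.
have [e eE] := choice H.
have eB : zmod_morphism e.
  move=> y z; have [x xn xc] := coherent_extension t y.
  have [x' xn' xc'] := coherent_extension t z.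
  rewrite (eE y x) // (eE z x') // -[- ultra_class _ _]/(ultra_opp _) ultra_oppE.
  rewrite [RHS]ultra_addE; apply: eE; last by rewrite xn xn'.
  by move=> m nm; rewrite xc // xc' // rmorphB.
have eM : monoid_morphism e.
  split; first by apply: (eE 1 (fun=> 1)) => // m _; rewrite rmorph1.
  move=> y z; have [x xn xc] := coherent_extension t y.
  have [x' xn' xc'] := coherent_extension t z.
  rewrite (eE y x) // (eE z x') // [RHS]ultra_mulE.
  apply: eE; last by rewrite xn xn'.
  by move=> m nm; rewrite xc // xc' // rmorphM.
pose G1 := GRing.isZmodMorphism.Build _ _ e eB.
pose G2 := GRing.isMonoidMorphism.Build _ _ e eM.
pose G : {rmorphism K n -> ultraproduct UU K} := HB.pack e G1 G2.
by exists G => x xc; apply: eE.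
Qed.

(** The direct limit is realised as the union of the images of the fields [K n] in
an ultraproduct of all of them. *)
Lemma direct_limit : exists (L : fieldType) (e : forall n, {rmorphism K n -> L}),
  (forall n x, e n.+1 (t n x) = e n x) /\ (forall y, exists n x, e n x = y).
Proof.
have [U [UU Uoo]] := ultraFilterLemma (eventually_filter).
have H n := cid (coherent_embedding UU Uoo n).
pose e n := projT1 (H n); have eE n := projT2 (H n); rewrite -/(e _) in eE.
have et n x : e n.+1 (t n x) = e n x.
  have [z zn zc] := coherent_extension t x.
  rewrite -zn (eE n z zc) -zc //; apply: eE.
  by move=> m nm; apply: zc; apply: ltnW.
have push := limit_push et.
pose S w := exists n x, e n x = w.
have common w w' : S w -> S w' -> exists n x x', e n x = w /\ e n x' = w'.
  move=> [n [x <-]] [n' [x' <-]].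
  have [y ey] := push n (maxn n n') x (leq_maxl _ _).
  have [y' ey'] := push n' (maxn n n') x' (leq_maxr _ _).
  by exists (maxn n n'), y, y'.
have [|||L [i iE]] := @subfield_exists _ S.
- by exists 0, 1; rewrite rmorph1.
- by move=> w w' Sw /(common _ _ Sw) [n [x [x' [<- <-]]]];
  exists n, (x - x'); rewrite rmorphB.
- by move=> w w' Sw /(common _ _ Sw) [n [x [x' [<- <-]]]];
  exists n, (x / x'); rewrite fmorph_div.
have Hg n : exists g : {rmorphism K n -> L}, forall x, i (g x) = e n x.
  by apply: rmorphism_factor => x; apply/iE; exists n, x.
pose g n := projT1 (cid (Hg n)); have gE n := projT2 (cid (Hg n)); rewrite -/(g _) in gE.
exists L, g; split=> [n x|y].
  by apply: (fmorph_inj i); rewrite !gE et.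
have /iE [n [x ex]] : exists z, i z = i y by exists y.
by exists n, x; apply: (fmorph_inj i); rewrite gE.
Qed.

End DirectLimit.

Section Descent.
Variables (K : nat -> fieldType) (t : forall n, {rmorphism K n -> K n.+1}).
Variables (L : fieldType) (e : forall n, {rmorphism K n -> L}).
Hypotheses (et : forall n x, e n.+1 (t n x) = e n x)
  (e_surj : forall y, exists n x, e n x = y).

Lemma limit_finite (J : finType) (y : J -> L) :
  exists N, forall n, (N <= n)%N -> exists x : J -> K n, forall j, e n (x j) = y j.
Proof.
have H j := cid (e_surj (y j)); pose N := (\max_j projT1 (H j))%N; exists N => n Nn.
suff /choice [x ex] : forall j, exists x, e n x = y j by exists x.
move=> j; have [x <-] := projT2 (H j).
apply: (limit_push et); apply: leq_trans Nn.
rewrite /N. exact: (@leq_bigmax J (fun j => projT1 (H j)) j).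
Qed.

Lemma limit_matrix k l (M : 'M[L]_(k, l)) :
  exists N, forall n, (N <= n)%N -> exists M' : 'M_(k, l), map_mx (e n) M' = M.
Proof.
have [N HN] := limit_finite (fun u : 'I_k * 'I_l => M u.1 u.2).
exists N => n /HN [x ex]; exists (\matrix_(u, v) x (u, v)).
by apply/matrixP => u v; rewrite !mxE ex.
Qed.

End Descent.

(** * An extension where factors of one form are factors of the other *)

Section Saturation.
Variables (F : fieldType) (p r : nat) (a b c : nat -> F).
Hypotheses (c2 : (2%:R : F) != 0) (rp : (r <= p)%N) (sep : separated p a b c).

Definition stage : Type :=
  {X : extension F | separated p (projT2 X \o a) (projT2 X \o b) (projT2 X \o c)}.

Lemma next_stage_exists (X : stage) :
  exists Y : extension (projT1 (sval X)),
    separated p (projT2 Y \o (projT2 (sval X) \o a)) (projT2 Y \o (projT2 (sval X) \o b))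
      (projT2 Y \o (projT2 (sval X) \o c)) /\
    forall s, nonzero_upto r s ->
      links p r (projT2 Y) (projT2 (sval X) \o a) (projT2 (sval X) \o b) s.
Proof. exact: (link_all_forms rp (two_neq0_map (projT2 (sval X)) c2) (proj2_sig X)). Qed.

Definition next_extension X := projT1 (cid (next_stage_exists X)).

Definition next_stage (X : stage) : stage :=
  exist _ (@Extension F (projT1 (next_extension X))
    [the {rmorphism F -> projT1 (next_extension X)} of
      projT2 (next_extension X) \o projT2 (sval X)])
  (proj1 (projT2 (cid (next_stage_exists X)))).

Definition first_stage : stage := exist _ (Extension idfun) sep.

Definition tower n : stage := iter n next_stage first_stage.
Definition tower_field n : fieldType := projT1 (sval (tower n)).
Definition tower_base n : {rmorphism F -> tower_field n} := projT2 (sval (tower n)).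
Definition tower_map n : {rmorphism tower_field n -> tower_field n.+1} :=
  projT2 (next_extension (tower n)).

Lemma tower_baseS n x : tower_base n.+1 x = tower_map n (tower_base n x).
Proof. by []. Qed.

Lemma tower_separated n :
  separated p (tower_base n \o a) (tower_base n \o b) (tower_base n \o c).
Proof. exact: (proj2_sig (tower n)). Qed.

Lemma tower_links n s : nonzero_upto r s ->
  links p r (tower_map n) (tower_base n \o a) (tower_base n \o b) s.
Proof. exact: (proj2 (projT2 (cid (next_stage_exists (tower n))))). Qed.

(** At each level of the tower all forms of the preceding level have been
treated.  A form over the limit that is contained in phi or psi comes, with the
embedding, from some level [n], and the required embedding exists at level
[n.+1]. *)
Lemma linked_extension :
  exists (L : fieldType) (f : {rmorphism F -> L}),
    separated p (f \o a) (f \o b) (f \o c) /\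
    forall s, nonzero_upto r s ->
      (subform (pfister r s) (pfister p.+2 (f \o a)) <->
       subform (pfister r s) (pfister p.+2 (f \o b))).
Proof.
have [L [e [et e_surj]]] := direct_limit tower_map.
pose f : {rmorphism F -> L} := [the {rmorphism F -> L} of e 0%N \o tower_base 0].
have fE n x : f x = e n (tower_base n x).
  by elim: n => // n ->; rewrite tower_baseS et.
have pE n k x : pfister k (f \o x) = map_mx (e n) (pfister k (tower_base n \o x)).
  by rewrite map_pfister; apply: eq_pfister => i _; rewrite /= (fE n).
have aniso x : (forall n, anisotropic (pfister p.+2 (tower_base n \o x))) ->
    anisotropic (pfister p.+2 (f \o x)).
  move=> ax v; have [N HN] := limit_matrix et e_surj v.
  have [v' <-] := HN N (leqnn N).
  rewrite (pE N) qf_map => /eqP; rewrite fmorph_eq0 => /eqP /ax ->.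
  by rewrite map_mx0.
have descend q s x : nonzero_upto q s ->
    subform (pfister q s) (pfister p.+2 (f \o x)) ->
    exists n s', [/\ nonzero_upto q s', pfister q s = pfister q (e n \o s')
      & subform (pfister q s') (pfister p.+2 (tower_base n \o x))].
  move=> hs [P eP]; have [N1 H1] := limit_matrix et e_surj P.
  have [N2 H2] := limit_finite et e_surj (fun i : 'I_q => s i).
  pose n := maxn N1 N2.
  have [P' eP'] := H1 n (leq_maxl _ _); have [s' es'] := H2 n (leq_maxr _ _).
  pose s'' i := if insub i is Some j then s' j else 0.
  have es i : (i < q)%N -> s i = e n (s'' i).
    by move=> iq; rewrite /s'' insubT es'.
  have eps : pfister q s = pfister q (e n \o s'') by apply: eq_pfister.
  exists n, s''; split=> //.
    by move=> i iq; rewrite -(fmorph_eq0 (e n)) -es // hs.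
  apply: (@subform_map_inj _ _ (e n) _ _ _ _ P').
  by rewrite eP' -pE eP map_pfister eps.
exists L, f; split.
  have [[ha hb hc] [_ _ sca _]] := sep.
  split; first by split; apply: nonzero_upto_map.
  split.
  - by apply: aniso => n; have [_ [h _ _ _]] := tower_separated n; exact: h.
  - by apply: aniso => n; have [_ [_ h _ _]] := tower_separated n; exact: h.
  - exact: subform_pfister_map.
  - case=> P eP; have [N HN] := limit_matrix et e_surj P; have [P' eP'] := HN N (leqnn N).
    have [_ [_ _ _ n_cb]] := tower_separated N; apply: n_cb.
    by apply: (@subform_map_inj _ _ (e N) _ _ _ _ P'); rewrite eP' -!pE.
have up n q s' x : subform (pfister q (tower_map n \o s'))
      (pfister p.+2 (tower_map n \o (tower_base n \o x))) ->
    subform (pfister q (e n \o s')) (pfister p.+2 (f \o x)).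
  move=> /(subform_pfister_map (e n.+1)).
  rewrite (@eq_pfister _ q _ (e n \o s')); last by move=> i _; rewrite /= et.
  by rewrite (@eq_pfister _ p.+2 _ (f \o x)) // => i _; rewrite [RHS](fE n.+1).
move=> s hs; split=> /(descend _ _ _ hs) [n [s' [hs' -> h]]]; apply: up.
  by have [l1 _] := tower_links hs'; exact: (l1 h).
by have [_ l2] := tower_links hs'; exact: (l2 h).
Qed.

End Saturation.

(** * Gram matrices of quadratic forms *)

Section GramOfForms.
Variable F : fieldType.
Hypothesis c2 : (2%:R : F) != 0.

Definition gram (q : qform F) : 'M[F]_(qdim q) := 2%:R^-1 *: (qmx q + (qmx q)^T).

Lemma symmx_gram q : symmx (gram q).
Proof. by rewrite /symmx /gram tr_scale linearD /= trmxK addrC. Qed.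

Lemma qf_gram q x : qf (gram q) x = qeval x.
Proof.
rewrite qf_scale /qf /bf mulmxDr mulmxDl mxE.
have -> : x *m (qmx q)^T *m x^T = (x *m qmx q *m x^T)^T.
  by rewrite !trmx_mul trmxK mulmxA.
by rewrite [in X in _ + X]mxE -mulr2n -[X in _ * X]mulr_natl mulKf.
Qed.

Lemma polar_gram q x y : polar (q := q) x y = 2%:R * bf (gram q) x y.
Proof. by rewrite polarE /bf /gram -scalemxAr -scalemxAl [in RHS]mxE mulVKf. Qed.

Lemma bijective_mulmxr m n (P : 'M[F]_(m, n)) :
  m = n -> row_free P -> bijective (mulmxr P : 'rV_m -> 'rV_n).
Proof.
move=> e; subst n; rewrite row_free_unit => uP.
by exists (mulmxr (invmx P)) => x /=; rewrite ?mulmxK ?mulmxKV.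
Qed.

Lemma qisometric_of_subform q1 q2 : qdim q1 = qdim q2 -> gram q1 \in unitmx ->
  subform (gram q1) (gram q2) -> qisometric q1 q2.
Proof.
move=> e u1 [P eP]; exists (mulmxr P); split.
  exact: bijective_mulmxr (subform_row_free u1 eP).
by move=> x; rewrite -!qf_gram /= qf_mul eP.
Qed.

Lemma subform_of_qisometric q1 q2 : qisometric q1 q2 ->
  [/\ qdim q1 = qdim q2, subform (gram q1) (gram q2) & subform (gram q2) (gram q1)].
Proof.
move=> [f [bf fq]]; pose P := lin1_mx f.
have PE x : x *m P = f x by rewrite mul_rV_lin1.
have fP : row_free P.
  rewrite -kermx_eq0; apply/eqP/row_matrixP => i; rewrite row0.
  by apply: (bij_inj bf); rewrite linear0 -PE -row_mul mulmx_ker row0.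
have fP' : row_full P.
  rewrite -sub1mx; apply/row_subP => i; have [g _ gK] := bf.
  by rewrite -[row i _]gK -PE submxMl.
have e : qdim q1 = qdim q2.
  by apply/eqP; rewrite eqn_leq -{1}(eqP fP) rank_leq_col -{1}(eqP fP') rank_leq_row.
have eP : P *m gram q2 *m P^T = gram q1.
  apply: qf_ext => //; first exact: symmx_conj (symmx_gram q2).
    exact: symmx_gram.
  by move=> x; rewrite -qf_mul PE !qf_gram fq.
by split=> //; [exists P | apply: subform_conj_rev eP].
Qed.

(** The matrix of the map [x |-> v (x) x].  It is given by its rows because the Kronecker
product of [v] with an identity matrix has [1 * n] rows. *)
Definition tens_vector n k (v : 'rV[F]_k) : 'M[F]_(n, k * n) :=
  \matrix_(i < n) (v *t (delta_mx 0 i : 'rV_n) : 'rV_(k * n)).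

Lemma tens_vectorE n k (D : 'M[F]_k) (M : 'M[F]_n) v w :
  tens_vector n v *m (D *t M) *m (tens_vector n w)^T = bf D v w *: M.
Proof.
apply/matrixP => i j; rewrite -bf_row !rowK mxE /bf mulmx_tens_row.
by rewrite -[X in _ * X]/(bf M _ _) bf_delta.
Qed.

Lemma subform_tens k l n (A : 'M[F]_k) (B : 'M[F]_l) (G : 'M[F]_n) :
  subform A B -> subform (A *t G) (B *t G).
Proof.
case=> P <-; exists (P *t 1%:M).
by rewrite trmx_tens !tensmx_mul trmx1 mul1mx mulmx1.
Qed.

Lemma subform_tens_vector k n (D : 'M[F]_k) (M : 'M[F]_n) v :
  subform (qf D v *: M) (D *t M).
Proof. by exists (tens_vector n v); rewrite tens_vectorE. Qed.

Lemma subform_dsum_tens m n l (A : 'M[F]_m) (B : 'M[F]_n) (G : 'M[F]_l) :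
  subform (dsum (A *t G) (B *t G)) (dsum A B *t G).
Proof.
exists (col_mx (row_mx 1%:M 0 *t 1%:M) (row_mx 0 1%:M *t 1%:M)).
rewrite mul_col_mx tr_col_mx mul_col_row !trmx_tens !tensmx_mul trmx1 !mul1mx !mulmx1.
rewrite /dsum !tr_row_mx !mul_row_block !mul_row_col !trmx0 !trmx1.
by rewrite !(mulmx0, mul0mx, addr0, add0r, mul1mx, mulmx1) !tens0mx.
Qed.

Lemma gram_qtens B q : gram (qtens B q) = bmx B *t gram q.
Proof.
rewrite /gram /= trmx_tens bmx_sym.
by apply/matrixP => i j; rewrite !mxE mulrDr; ring.
Qed.

Lemma subform_btens_pair (a : F) n (M : 'M[F]_n) :
  subform (dsum M (a *: M)) (bmx (bdiag [:: 1; a]) *t M).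
Proof.
pose e (i : 'I_2) : 'rV[F]_2 := delta_mx 0 i.
exists (col_mx (tens_vector n (e 0)) (tens_vector n (e 1))).
rewrite mul_col_mx tr_col_mx mul_col_row !tens_vectorE !bf_delta.
by rewrite !mxE /= !mulr0n !mulr1n !scale0r scale1r.
Qed.

Lemma subform_qtens_step a s k l (X : 'M[F]_k) (M : 'M[F]_l) :
  subform X (bmx (bpfister s) *t M) ->
  subform (dsum X (a *: X)) (bmx (bpfister (a :: s)) *t M).
Proof.
move=> sX; apply: subform_trans (subform_tens M (subform_btens_pair a (bmx (bpfister s)))).
apply: subform_trans (subform_dsum_tens _ _ _).
apply: subform_dsum => //.
have -> : (a *: bmx (bpfister s)) *t M = a *: (bmx (bpfister s) *t M).
  by apply/matrixP => i j; rewrite !mxE mulrA.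
exact: subform_scale.
Qed.

Lemma bdim_bpfister s : bdim (@bpfister F s) = pdim (size s).
Proof. by elim: s => //= a s ->; rewrite mul2n addnn. Qed.

End GramOfForms.

(** * Pfister forms and their slots *)

(** The outermost slot comes first, as in [bpfister]. *)
Fixpoint slots (F : fieldType) (x : nat -> F) (r k : nat) : seq F :=
  if k is k'.+1 then x (r + k')%N :: slots x r k' else [::].

Section PfisterTranslation.
Variable F : fieldType.
Hypothesis c2 : (2%:R : F) != 0.
Implicit Types (x y : nat -> F) (q rho pi : qform F).

Lemma size_slots x r k : size (slots x r k) = k.
Proof. by elim: k => //= k ->. Qed.

Lemma slots_neq0 x r k :
  all (fun a => a != 0) (slots x r k) <->
  (forall i, (r <= i < r + k)%N -> x i != 0).
Proof.
elim: k => [|k IH] /=.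
  by split=> // _ i; rewrite addn0 => /andP[ri]; rewrite ltnNge ri.
split=> [/andP[xk /IH hx] i|hx].
  rewrite addnS ltnS (leq_eqVlt i) => /andP[ri /orP[/eqP -> //|ik]].
  by apply: hx; rewrite ri.
rewrite hx ?leq_addr ?addnS ?ltnSn //=; apply/IH => i /andP[ri ik].
by apply: hx; rewrite ri addnS ltnW.
Qed.

Lemma eq_slots x y r k :
  (forall i, (i < r + k)%N -> x i = y i) -> slots x r k = slots y r k.
Proof.
elim: k => //= k IH hxy; rewrite hxy ?addnS ?ltnSn // IH // => i ik.
by apply: hxy; rewrite addnS ltnW.
Qed.

Lemma slots_exist y r (s : seq F) :
  exists x, (forall i, (i < r)%N -> x i = y i) /\ slots x r (size s) = s.
Proof.
elim: s => [|a s [x [xy xs]]]; first by exists y.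
exists (fun i => if i == (r + size s)%N then a else x i); split=> [i ir|].
  by rewrite ltn_eqF ?xy // (leq_trans ir) // leq_addr.
by rewrite /= eqxx -[in RHS]xs; congr cons; apply: eq_slots => i /ltn_eqF ->.
Qed.

Lemma subform_pfister_slots rho x r k : subform (pfister r x) (gram rho) ->
  subform (pfister (r + k) x) (gram (qtens (bpfister (slots x r k)) rho)).
Proof.
move=> sx; rewrite gram_qtens; elim: k => [|k IH].
  rewrite addn0; apply: subform_trans sx _.
  have := @subform_tens_vector _ _ _ (bmx (bdiag [:: 1])) (gram rho) (delta_mx 0 0).
  by rewrite /qf bf_delta !mxE eqxx scale1r.
by rewrite addnS /=; apply: subform_qtens_step.
Qed.

(** Completing the square: [x^2 + x y + b y^2 = (x + y / 2)^2 + (b - 1/4) y^2]. *)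
Lemma subform_qbin b x : x 0%N = b - 4%:R^-1 ->
  subform (pfister 1 x) (gram (qbin 1 1 b)) /\
  subform (gram (qbin 1 1 b)) (pfister 1 x).
Proof.
move=> x0; pose P : 'M[F]_(1 + 1) := block_mx 1%:M 0 (- 2%:R^-1)%:M 1%:M.
have fP : row_free P by rewrite row_free_unit unitmxE det_lblock !det1 mul1r unitr1.
suff eP : P *m gram (qbin 1 1 b) *m P^T = pfister 1 x.
  by split; [exists P | apply: subform_conj_rev eP].
rewrite /= x0.
have -> : gram (qbin 1 1 b) = block_mx 1%:M (2%:R^-1)%:M (2%:R^-1)%:M b%:M.
  rewrite /gram /= tr_block_mx add_block_mx scale_block_mx !tr_scalar_mx trmx0.
  rewrite addr0 add0r !scale_scalar_mx !mulr1 -!raddfD /= !scale_scalar_mx.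
  by congr block_mx; congr (_%:M); field.
rewrite tr_block_mx !tr_scalar_mx trmx0 !mulmx_block.
rewrite !(mulmx0, mul0mx, addr0, add0r, mul1mx, mulmx1) /dsum.
rewrite -!scalar_mxM -!raddfD /= -!scalar_mxM -!raddfD /= scalemx1 addNr.
rewrite mul0r add0r !(raddf0 (@scalar_mx F 1)) (natrM _ 2 2).
have c4 : (4%:R : F) != 0 by rewrite (natrM _ 2 2) mulf_neq0.
by congr block_mx; congr (_%:M); field; rewrite c4 c2.
Qed.

Lemma nonsingular_gram q : nonsingular q <-> gram q \in unitmx.
Proof.
split=> [ns|uq x qx].
  rewrite -row_free_unit -kermx_eq0; apply/eqP/row_matrixP => i; rewrite row0.
  apply: ns => y; rewrite polar_gram // /bf -row_mul mulmx_ker row0 mul0mx mxE.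
  exact: mulr0.
apply: (can_inj (mulmxK uq)); rewrite mul0mx; apply/rowP => j.
have /eqP := qx (delta_mx 0 j); rewrite polar_gram // mulf_eq0 (negPf c2) /=.
by rewrite /bf trmx_delta -colE !mxE => /eqP.
Qed.

Lemma qpfisterP n q : is_qpfister n q <->
  (0 < n)%N /\ exists a, [/\ nonzero_upto n a, qdim q = pdim n
    & subform (pfister n a) (gram q)].
Proof.
have dimE s b : qdim (qtens (bpfister s) (qbin 1 1 b)) = pdim (size s).+1.
  by rewrite /= bdim_bpfister addn1 muln2 addnn.
split=> [[s [b [<- hs nsb iso]]]|[n0 [a [ha dq sa]]]].
  split=> //; have [eq s1 s2] := subform_of_qisometric c2 iso.
  have [x [x0 xs]] := slots_exist (fun=> b - 4%:R^-1) 1 s.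
  have sx := subform_pfister_slots (size s) (proj1 (subform_qbin (x0 0%N (ltnSn 0)))).
  rewrite xs add1n in sx.
  exists x; split; [|by rewrite eq dimE|exact: subform_trans sx s2].
  have /nonsingular_gram ub := nsb.
  have := unit_of_subform erefl ub (proj2 (subform_qbin (x0 0%N (ltnSn 0)))).
  rewrite /= unit_dsum => /andP[_]; rewrite scalemx1 unitmxE det_scalar1 unitfE => x00.
  case=> [_|i ilt]; first exact: x00.
  by move: hs; rewrite -xs => /slots_neq0; apply; rewrite add1n ilt.
pose b := a 0%N + 4%:R^-1.
have sb : subform (pfister 1 a) (gram (qbin 1 1 b)).
  by apply: (proj1 (subform_qbin _)); rewrite /b addrK.
have sx := subform_pfister_slots n.-1 sb; rewrite add1n prednK // in sx.
have un := unit_pfister ha.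
exists (slots a 1 n.-1), b; split.
- by rewrite size_slots prednK.
- apply/slots_neq0 => i /andP[_]; rewrite add1n prednK //; apply: ha.
- apply/nonsingular_gram; apply: (unit_of_subform _ _ sb) => //.
  by apply: unit_pfister => i i1; apply: ha; apply: leq_trans i1 n0.
apply: qisometric_of_subform => //.
- by rewrite dimE size_slots prednK.
- exact: unit_of_subform (esym dq) un sa.
- apply: subform_trans sx.
  by apply: subform_rev sa.
Qed.

End PfisterTranslation.

(** * Factors and hyperbolicity *)

(** The form with slots [y] below [r + k] is enlarged by a value [b] of its complement.
With its multiple by [b] it makes a Pfister form sharing more than half of its
dimension with the given one, hence contained in it. *)
Lemma pfister_extend (K : fieldType) r k n (x a : nat -> K) :
  (2%:R : K) != 0 -> (r + k <= n)%N -> nonzero_upto r x -> nonzero_upto n a ->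
  anisotropic (pfister n a) -> subform (pfister r x) (pfister n a) ->
  exists y, [/\ forall i, (i < r)%N -> y i = x i, nonzero_upto (r + k) y
    & subform (pfister (r + k) y) (pfister n a)].
Proof.
move=> c2; elim: k => [|k IH] rkn hx ha aA sx.
  by rewrite addn0; exists x.
rewrite addnS in rkn *; have [y [yx hy sy]] := IH (ltnW rkn) hx ha aA sx.
have uy := unit_pfister hy.
have [m [T [em sT s1 _ aT]]] := subform_complement (symmx_pfister n a) uy sy.
have {}aT := aT aA.
have m0 : (0 < m)%N.
  by have := ltn_pdim rkn; rewrite -em -{1}[pdim _]add0n ltn_add2r.
pose v : 'rV[K]_m := const_mx 1; pose b := qf T v.
have b0 : b != 0.
  apply/eqP => /aT /rowP/(_ (Ordinal m0)); rewrite !mxE => /eqP.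
  by rewrite oner_eq0.
pose z i := if i == (r + k)%N then b else y i.
have zy i : (i < r + k)%N -> z i = y i by move=> /ltn_eqF; rewrite /z => ->.
have hz : nonzero_upto (r + k).+1 z.
  by move=> i; rewrite ltnS leq_eqVlt /z; case: eqP => //= _ /hy.
exists z; split=> //; first by move=> i ir; rewrite zy ?yx // (leq_trans ir) ?leq_addr.
have ez : pfister (r + k).+1 z = dsum (pfister (r + k) y) (b *: pfister (r + k) y).
  by rewrite /= (eq_pfister zy) /z eqxx.
(* the common part exceeds half of the dimension of the enlarged form by 1 *)
pose S : 'M_(pdim (r + k) + 1) := dsum (pfister (r + k) y) (b%:M : 'M_1).
apply: (@subform_of_big_common _ _ _ _ _ _ S) => //.
- by rewrite unit_dsum uy unit_scalar.
- by rewrite addn1.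
- rewrite ez; apply: subform_dsum; first exact: subform_refl.
  have [w qw] := pfister_represents1 (r + k) y.
  by exists w; apply: mulmx_line; rewrite qf_scale qw mulr1.
- apply: subform_trans s1; apply: subform_dsum; first exact: subform_refl.
  by exists v; apply: mulmx_line.
Qed.

Section Factors.
Variable F : fieldType.
Hypothesis c2 : (2%:R : F) != 0.

Lemma bpfister_represents1 (s : seq F) : exists v, beval (B := bpfister s) v v = 1.
Proof.
elim: s => [|a s [v qv]].
  by exists (delta_mx 0 0); rewrite /beval -[LHS]/(bf _ _ _) bf_delta !mxE eqxx.
exists ((delta_mx 0 0 : 'rV_2) *t v); rewrite /beval mulmx_tens_row.
rewrite -[X in _ * X]/(beval v v) qv.
by rewrite -[X in X * _]/(bf _ _ _) bf_delta !mxE eqxx mulr1.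
Qed.

Lemma subform_qtens_represents1 (B : bform F) q m : is_bpfister m B ->
  subform (gram q) (gram (qtens B q)).
Proof.
move=> [s [_ _ [f [bf fB]]]]; have [g _ gK] := bf.
have [v qv] := bpfister_represents1 s.
rewrite gram_qtens; have := subform_tens_vector (bmx B) (gram q) (g v).
by have -> : qf (bmx B) (g v) = 1; [rewrite -qv -[in RHS](gK v) fB | rewrite scale1r].
Qed.

Lemma bisometric_refl (B : bform F) : bisometric B B.
Proof. by exists idfun; split=> //; exists idfun. Qed.

(** A bilinear Pfister form represents 1, so a factor is a subform.  Conversely the
slots of a subform are completed to slots of the whole form. *)
Lemma factorP m n (rho pi : qform F) : is_qpfister m rho -> is_qpfister n pi -> (m <= n)%N ->
  anisotropic (gram pi) -> is_factor m n rho pi <-> subform (gram rho) (gram pi).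
Proof.
move=> prho ppi mn api; split=> [[_ _ _ [B [pB iso]]]|sub].
  have [_ _ s2] := subform_of_qisometric c2 iso.
  exact: subform_trans (subform_qtens_represents1 _ pB) s2.
split=> //; have [m0 [x [hx dx sx]]] := (qpfisterP c2 _ _).1 prho.
have [n0 [a [ha da sa]]] := (qpfisterP c2 _ _).1 ppi.
have pia := subform_rev (esym da) (unit_pfister ha) sa.
have aa : anisotropic (pfister n a) by apply: anisotropic_subform (unit_pfister ha) sa api.
have [||y [yx hy sy]] := @pfister_extend F m (n - m) n x a c2 _ hx ha aa _.
- by rewrite subnKC.
- exact: subform_trans sx (subform_trans sub pia).
have {}sx : subform (pfister m y) (gram rho) by rewrite (eq_pfister yx).
have st := subform_pfister_slots (n - m) sx; rewrite subnKC // in hy sy st.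
have uy := unit_pfister hy.
have dt : qdim (qtens (bpfister (slots y m (n - m))) rho) = pdim n.
  by rewrite /= bdim_bpfister size_slots dx !pdimE -expnD subnK.
exists (bpfister (slots y m (n - m))); split.
  exists (slots y m (n - m)); split; first exact: size_slots.
    by apply/slots_neq0 => i /andP[_]; rewrite subnKC // => /hy.
  exact: bisometric_refl.
apply: qisometric_of_subform => //; first by rewrite da dt.
  exact: unit_of_subform (esym da) (unit_pfister ha) sa.
apply: subform_trans st; apply: subform_trans pia _.
by apply: subform_rev sy.
Qed.

Lemma not_hyperbolic (q : qform F) : anisotropic (gram q) -> (0 < qdim q)%N -> ~ hyperbolic q.
Proof.
move=> aq q0 [k iso]; have [dq _ _] := subform_of_qisometric c2 iso.
have [f [bf fq]] := iso; have [g fK gK] := bf.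
have k0 : (0 < k)%N.
  by move: q0; rewrite dq /=; case: (k) => //; rewrite big_ord0.
(* an isotropic vector: the sum of the first basis vectors of all the planes *)
pose v : 'rV[F]_(\sum_(i < k) (1 + 1)) := \mxrow_(i < k) row_mx 1%:M 0.
have v0 : v != 0.
  apply/eqP => /(congr1 (fun w => submxrow w (Ordinal k0))).
  rewrite mxrowK => /(congr1 lsubmx); rewrite row_mxKl => /matrixP/(_ 0 0)/eqP.
  by rewrite !mxE oner_eq0.
move/eqP: v0; apply; rewrite -[v]gK (aq (g v)).
  exact: linear0.
rewrite qf_gram // -fq gK /qeval /= mul_mxrow_mxdiag tr_mxrow mul_mxrow_mxcol.
rewrite big1 ?mxE // => i _.
rewrite mul_row_block tr_row_mx mul_row_col !mul1mx !mul0mx trmx0 mulmx0 !addr0.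
by rewrite (raddf0 (@scalar_mx F 1)) mul0mx.
Qed.

(** Dual vectors to the rows of [Z], corrected by half their Gram matrix so as to
become isotropic, complete these rows to a basis of hyperbolic pairs. *)
Lemma hyperbolic_of_lagrangian (q : qform F) h (Z : 'M_(h, qdim q)) :
  qdim q = (h + h)%N -> gram q \in unitmx -> row_free Z -> Z *m gram q *m Z^T = 0 ->
  hyperbolic q.
Proof.
move=> dq uG fZ ZZ; set G2 := qmx q + (qmx q)^T.
have G2E : G2 = 2%:R *: gram q by rewrite scalerA mulfV // scale1r.
have sG2 : symmx G2 by rewrite G2E; apply/symmx_scale/symmx_gram.
have ZZ2 : Z *m G2 *m Z^T = 0 by rewrite G2E -scalemxAr -scalemxAl ZZ scaler0.
have uG2 : G2 \in unitmx by rewrite G2E unit_scale.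
have /row_freeP [X ZX] : row_free (Z *m G2) by rewrite /row_free mxrankMfree // row_free_unit.
pose S := X^T *m G2 *m X.
have GZX : X^T *m G2 *m Z^T = 1%:M.
  by rewrite -[RHS]trmx1 -ZX !trmx_mul sG2 mulmxA.
have sS : S^T = S by have := symmx_conj X^T sG2; rewrite trmxK.
(* [X^T] is dual to [Z] and has Gram matrix [S] *)
pose Y := X^T - 2%:R^-1 *: (S *m Z).
have ZY : Z *m G2 *m Y^T = 1%:M.
  rewrite /Y linearB /= tr_scale trmx_mul trmxK mulmxBr ZX -scalemxAr mulmxA ZZ2.
  by rewrite mul0mx scaler0 subr0.
have YY : Y *m G2 *m Y^T = 0.
  rewrite {1}/Y !mulmxBl -!scalemxAl -(mulmxA S) -(mulmxA S) ZY mulmx1.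
  rewrite /Y linearB /= tr_scale trmx_mul trmxK mulmxBr -/S -scalemxAr mulmxA.
  rewrite GZX mul1mx sS -{1}[S]scale1r -!scalerBl -[RHS](scale0r S); congr (_ *: _).
  by field.
have YZ : Y *m G2 *m Z^T = 1%:M.
  by rewrite -[RHS]trmx1 -ZY !trmx_mul trmxK sG2 mulmxA.
pose H := QForm (\mxdiag_(i < h) qmx (hyperbolic_plane F)).
pose P : 'M_(\sum_(i < h) (1 + 1), qdim q) := \mxcol_(i < h) col_mx (row i Z) (row i Y).
have block_entry i j : col_mx (row i Z) (row i Y) *m G2 *m (col_mx (row j Z) (row j Y))^T =
    if i == j then qmx (hyperbolic_plane F) + (qmx (hyperbolic_plane F))^T else 0.
  have entry (U V : 'M_(h, qdim q)) (M : 'M_h) : U *m G2 *m V^T = M ->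
      row i U *m G2 *m (row j V)^T = (M i j)%:M.
    by move=> <-; rewrite bf_mx bf_row.
  rewrite mul_col_mx tr_col_mx mul_col_row.
  rewrite (entry _ _ _ ZZ2) (entry _ _ _ ZY) (entry _ _ _ YZ) (entry _ _ _ YY) !mxE.
  rewrite /= tr_block_mx add_block_mx !tr_scalar_mx trmx0 !addr0 add0r.
  rewrite !(raddf0 (@scalar_mx F 1)) addr0.
  by case: eqVneq => _; rewrite ?mulr1n // mulr0n (raddf0 (@scalar_mx F 1)) block_mx0.
have HE : P *m G2 *m P^T = qmx H + (qmx H)^T.
  rewrite /P tr_mxcol mxcol_mul mul_mxcol_mxrow /= tr_mxdiag -mxdiagD /mxdiag.
  apply/eq_mxblock => i j; rewrite block_entry.
  by case: eqVneq => // e; subst j; rewrite conform_mx_id.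
have subH : subform (gram H) (gram q) by exists P; rewrite -scalemxAr -scalemxAl HE.
have dH : qdim H = qdim q by rewrite dq /= sum_nat_const card_ord muln2 addnn.
have uH : gram H \in unitmx.
  rewrite /gram unit_scale ?invr_eq0 //.
  rewrite /= tr_mxdiag -mxdiagD.
  pose C : 'M[F]_(1 + 1) := qmx (hyperbolic_plane F) + (qmx (hyperbolic_plane F))^T.
  change (\mxdiag_(i < h) C \in unitmx).
  suff /mulmx1_unit [] : \mxdiag_(i < h) C *m \mxdiag_(i < h) C = 1%:M by [].
  rewrite {2}/mxdiag mul_mxdiag_mxblock -mxdiagZ /mxdiag; apply/eq_mxblock => i j.
  case: eqVneq => [_|_]; last by rewrite mulmx0.
  rewrite !conform_mx_id /C /= tr_block_mx add_block_mx !tr_scalar_mx trmx0 !addr0 add0r.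
  rewrite !(raddf0 (@scalar_mx F 1)) !addr0 mulmx_block.
  by rewrite !(mulmx0, mul0mx, addr0, add0r, mul1mx) -scalar_mx_block.
exists h; apply: qisometric_of_subform => //.
exact: subform_rev subH.
Qed.

Lemma hyperbolic_of_isotropic n (q : qform F) : is_qpfister n q -> ~ anisotropic (gram q) ->
  hyperbolic q.
Proof.
move=> /(qpfisterP c2) [n0 [a [ha da sa]]] nq.
case: n n0 ha da sa => // n _ ha da sa.
have ua := unit_pfister ha; have qa := subform_rev (esym da) ua sa.
have na : ~ anisotropic (pfister n.+1 a).
  exact: isotropic_subform (unit_of_subform (esym da) ua sa) qa nq.
have [Z fZ ZZ] := isotropic_pfister ha na.
have [P eP] := sa; have fP := subform_row_free ua eP.
apply: (@hyperbolic_of_lagrangian _ _ (Z *m P)) => //.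
- exact: unit_of_subform (esym da) ua sa.
- by rewrite /row_free mxrankMfree.
- by rewrite mulmx_conj eP.
Qed.

End Factors.

(** * Total linkage after scalar extension *)

Lemma gram_qext (F K : fieldType) (f : {rmorphism F -> K}) (q : qform F) :
  gram (qext f q) = map_mx f (gram q).
Proof.
by rewrite /gram /= map_mxZ map_mxD -map_trmx fmorphV rmorph_nat.
Qed.

(** The slots [a] are what is followed along field extensions. *)
Definition pfister_gram (F : fieldType) n (q : qform F) (a : nat -> F) : Prop :=
  [/\ nonzero_upto n a, qdim q = pdim n, subform (pfister n a) (gram q)
    & subform (gram q) (pfister n a)].

Lemma pfister_gram_exists (F : fieldType) n (q : qform F) : (2%:R : F) != 0 ->
  is_qpfister n q -> exists a, pfister_gram n q a.
Proof.
move=> c2 /(qpfisterP c2) [_ [a [ha dq sa]]]; exists a; split=> //.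
exact: subform_rev (unit_pfister ha) sa.
Qed.

Lemma is_qpfister_of_gram (F : fieldType) n (q : qform F) a : (2%:R : F) != 0 ->
  (0 < n)%N -> pfister_gram n q a -> is_qpfister n q.
Proof. by move=> c2 n0 [ha dq sa _]; apply/(qpfisterP c2); split=> //; exists a. Qed.

Lemma pfister_gram_ext (F K : fieldType) (f : {rmorphism F -> K}) n (q : qform F) a :
  pfister_gram n q a -> pfister_gram n (qext f q) (f \o a).
Proof.
move=> [ha dq sa qa]; split=> //; first exact: nonzero_upto_map.
  by rewrite gram_qext -map_pfister; apply: subform_map.
by rewrite gram_qext -map_pfister; apply: subform_map.
Qed.

Lemma anisotropic_pfister_gram (F : fieldType) n (q : qform F) a :
  pfister_gram n q a -> anisotropic (gram q) <-> anisotropic (pfister n a).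
Proof.
move=> [ha dq sa qa]; have ua := unit_pfister ha; split.
  exact: anisotropic_subform ua sa.
exact: anisotropic_subform (unit_of_subform (esym dq) ua sa) qa.
Qed.

Lemma subform_pfister_gram (F : fieldType) m n (rho q : qform F) s a :
  pfister_gram m rho s -> pfister_gram n q a ->
  subform (gram rho) (gram q) <-> subform (pfister m s) (pfister n a).
Proof.
move=> [_ _ s1 s2] [_ _ a1 a2]; split=> h.
  exact: subform_trans s1 (subform_trans h a2).
exact: subform_trans s2 (subform_trans h a1).
Qed.

Lemma factor_pfister_gram (F : fieldType) m n (rho q : qform F) s a :
  (2%:R : F) != 0 -> (0 < m <= n)%N -> anisotropic (pfister n a) ->
  pfister_gram m rho s -> pfister_gram n q a ->
  is_factor m n rho q <-> subform (pfister m s) (pfister n a).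
Proof.
move=> c2 /andP[m0 mn] aa ps pa; rewrite -(subform_pfister_gram ps pa).
apply: factorP => //; last exact/(anisotropic_pfister_gram pa).
  exact: is_qpfister_of_gram ps.
exact: is_qpfister_of_gram (leq_trans m0 mn) pa.
Qed.

Lemma not_hyperbolic_pfister_gram (F : fieldType) n (q : qform F) a :
  (2%:R : F) != 0 -> (0 < n)%N -> pfister_gram n q a ->
  ~ hyperbolic q <-> anisotropic (pfister n a).
Proof.
move=> c2 n0 pa; rewrite -(anisotropic_pfister_gram pa); split=> [nh|aq].
  apply: contrapT => nq; apply: nh.
  exact: (hyperbolic_of_isotropic c2 (is_qpfister_of_gram c2 n0 pa) nq).
apply: not_hyperbolic => //; have [_ dq _ _] := pa.
by rewrite dq pdimE expn_gt0.
Qed.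

Theorem theorem4p9 (F : fieldType) (n m : nat) (phi psi : qform F)
    (charF : 2%N \notin [pchar F])
    (n_ge3 : (3 <= n)%N)
    (m_range : (1 <= m <= n - 3)%N)
    (phi_pfister : is_qpfister n phi)
    (psi_pfister : is_qpfister n psi)
    (phi_nonhyp : ~ hyperbolic phi)
    (psi_nonhyp : ~ hyperbolic psi)
    (phi_psi_linked : linked n (n - 1) phi psi)
    (phi_psi_tlinked : totally_linked n m phi psi)
    (exists_omega : exists omega : qform F,
      [/\ is_qpfister (n - 1) omega,
          is_factor (n - 1) n omega phi,
          ~ is_factor (n - 1) n omega psi
        & exists tau : qform F,
            [/\ is_qpfister (n - 2) tau,
                is_factor (n - 2) (n - 1) tau omega
              & is_factor (n - 2) n tau psi]]) :
  exists (K : fieldType) (iota : {rmorphism F -> K}),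
    [/\ totally_linked n (m + 1) (qext iota phi) (qext iota psi),
        ~ totally_linked n (n - 1) (qext iota phi) (qext iota psi),
        ~ hyperbolic (qext iota phi)
      & ~ hyperbolic (qext iota psi)].
Proof.
have c2 : (2%:R : F) != 0 by move: charF; rewrite inE /=.
have [p np] : exists p, n = p.+2 by exists (n - 2)%N; lia.
subst n; have rp : (m + 1 <= p)%N by lia.
have [omega [omega_pfister omega_phi omega_psi _]] := exists_omega.
have e1 : (p.+2 - 1)%N = p.+1 by lia.
rewrite !e1 in omega_pfister omega_phi omega_psi *.
have [a pa] := pfister_gram_exists c2 phi_pfister.
have [b pb] := pfister_gram_exists c2 psi_pfister.
have [c pc] := pfister_gram_exists c2 omega_pfister.
have aa : anisotropic (pfister p.+2 a) by apply/(not_hyperbolic_pfister_gram c2 _ pa).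
have ab : anisotropic (pfister p.+2 b) by apply/(not_hyperbolic_pfister_gram c2 _ pb).
have pp : (0 < p.+1 <= p.+2)%N by rewrite ltn0Sn leqnSn.
have sep : separated p a b c.
  have [ha _ _ _] := pa; have [hb _ _ _] := pb; have [hc _ _ _] := pc.
  split; split; [exact: ha|exact: hb|exact: hc|exact: aa|exact: ab| |].
    exact/(factor_pfister_gram c2 pp aa pc pa).
  by move=> /(factor_pfister_gram c2 pp ab pc pb).
have [K [iota [[_ [aaK abK scaK ncbK]] link]]] := linked_extension c2 rp sep.
have c2K := two_neq0_map iota c2.
have paK := pfister_gram_ext iota pa; have pbK := pfister_gram_ext iota pb.
have pcK := pfister_gram_ext iota pc.
exists K, iota; split.
- move=> rho /(pfister_gram_exists c2K) [s ps].
  have mp : (0 < m + 1 <= p.+2)%N by lia.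
  rewrite (factor_pfister_gram c2K mp aaK ps paK) (factor_pfister_gram c2K mp abK ps pbK).
  by apply: link; case: ps.
- move=> /(_ _ (is_qpfister_of_gram c2K (ltn0Sn p) pcK)) [tl _]; apply: ncbK.
  apply/(factor_pfister_gram c2K pp abK pcK pbK) => //; apply: tl.
  exact/(factor_pfister_gram c2K pp aaK pcK paK).
- exact/(not_hyperbolic_pfister_gram c2K _ paK).
- exact/(not_hyperbolic_pfister_gram c2K _ pbK).
Qed.
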